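(* In the setting of the context, suppose that $y\in\mathcal A(\mu)$ is an admissible point and that $\overline{\mathcal F}(w,y)$ exists (in $\overline{\mathbb R}$). Then $$\lim_{k\to\infty}\Gamma_k(y)=\overline{\mathcal F}(w,y).$$
   Context: Conventions. Vector spaces are real; $X^*$ is the topological dual of $X$; a disk is a convex balanced set; measures are non-negative and $\sigma$-additive; a finite measure on the Borel $\sigma$-algebra $\mathcal B(X)$ is Radon if it is inner regular with respect to compact sets; $[f]_\nu$ is the $\nu$-a.e. equivalence class of $f$. Lusin subspaces and regular inner products. Let $X$ be a quasicomplete Hausdorff locally convex space and $\nu$ a Radon probability measure on $\mathcal B(X)$; $\nu^2$ is the unique Radon extension of $\nu\times\nu$ to $\mathcal B(X\times X)$. An affine subspace $Y\subseteq X$ is a $\nu$-Lusin affine subspace if for each $\epsilon>0$ there is a convex compact $K\subseteq Y$ with $\nu(K)\ge1-\epsilon$; $\mathcal A(\nu)$ is the intersection of all of these. Those containing $0$ are the $\nu$-Lusin linear subspaces; their intersection is $\mathcal H(\nu)$ (known to be identified with the dual of $\{[\phi]_\nu:\phi\in X^*\}$ under convergence in $\nu$-measure). A $\nu$-Lusin linear subspace is standard if it is a countable union of compact disks. $\mathcal I(\nu)$ is the set of $\nu^2$-measurable $f:X\times X\to\overline{\mathbb R}$ (identified if equal $\nu^2$-a.e.) for which there are continuous symmetric positive semidefinite bilinear $B_n:X\times X\to\mathbb R$ with $B_m(x,x)\le B_n(x,x)$ for $m\le n$ and $x\in X$, $\sup_nB_n(x,x)<\infty$ for $\nu$-a.e.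 $x$, and $B_n\to f$ in $\nu^2$-measure. A standard representation of $f\in\mathcal I(\nu)$ is a pair $(Y,B)$ with $Y$ a standard $\nu$-Lusin linear subspace and $B:Y\times Y\to\mathbb R$ symmetric positive semidefinite bilinear, continuous on $K\times K$ for every weakly compact convex $K\subseteq X$ contained in $Y$, with $f=[B]_{\nu^2}$. Standard representations exist, and (under the separability assumption below) $\tilde f(x):=B(x,x)$ is well defined $\nu$-a.e., and $\underline f:=B\upharpoonright\mathcal H(\nu)\times\mathcal H(\nu)$ is well defined everywhere, independently of $(Y,B)$. For $f,g\in\mathcal I(\nu)$, $f\le g$ means $f+h=g$ for some $h\in\mathcal I(\nu)$. Setting. $X$ is a quasicomplete Hausdorff locally convex space, $w\in X$, and $\mu$ is a Radon probability measure on $\mathcal B(X)$ with $\exp[\phi]\in L^1(\mu)$ for all $\phi\in X^*$. There is a sequence $(K_n)$ of hereditarily separable (every subset is separable) compact disks in $X$ with $\mu(\bigcup_nK_n)=1$. For $z\in X$, $\mu_{-z}$ is the image of $\mu$ under $x\mapsto x-z$. $(I_k)_{k\ge0}$ is an increasing family in $\mathcal I(\mu_{-w})$, $Q_k(x):=\tilde I_k(x-w)$, $N_k:=\int_X\exp[-\frac12Q_k]\,\mathrm d\mu$, $\mu_k:=N_k^{-1}\exp[-\frac12Q_k]\mu$. $D^+$ is the upper right Dini derivative in $k$, and $\Xi$ is the smallest $\sigma$-algebra on the complexification $(X^* )_{\mathbb C}$ making all evaluations at points of $X$ measurable. It is assumed that: (A1) for every $k\ge0$ there are a $\sigma$-finite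 measure space $(A_k,\Sigma_k,\kappa_k)$ and a $(\Sigma_k,\Xi)$-measurable $\omega^k:A_k\to(X^* )_{\mathbb C}$, $a\mapsto\omega^k_a$, such that for every $y\in\mathcal H(\mu_{-w})$ the function $a\mapsto\omega^k_a(y)$ is in $L^2_{\mathbb C}(\kappa_k)$ and $D^+\underline{I_k}(y,y)=\int_{A_k}|\omega^k_a(y)|^2\mathrm d\kappa_k(a)$; put $Q_k'(x):=\int_{A_k}|\omega^k_a(x-w)|^2\mathrm d\kappa_k(a)$ for $x\in X$; (A2) for every $l\ge0$, $Q_l'$ is $\mu$-measurable, and for every sequence $(k_n)$ in $[0,\infty)\setminus\{l\}$ with $k_n\to l$ there are $r_n>0$ with $r_n\to\infty$ and $\lim_n\int_X\exp\big[\big|\frac{r_n(Q_l-Q_{k_n})}{2(l-k_n)}-\frac{r_n}2Q_l'\big|-\frac{Q_l}2\big]\mathrm d\mu=\int_X\exp[-\frac{Q_l}2]\mathrm d\mu$; (A3) for every $k\ge0$ there is $R>0$ with $\int_X\exp[\frac1{2R}Q_k'-\frac12Q_k]\,\mathrm d\mu<\infty$; (A4) $I_0=0$ almost everywhere; (A5) there are positive reals $(r_k)_{k\ge0}$ with $\lim_{k\to\infty}r_k=\infty$ such that, with $J_k:=I_k/r_k^2$, for every $k\ge0$ there is $K\ge0$ with $J_k\le J_l$ for all $l\ge K$; (A6) for every sequence $k_n\nearrow\infty$ in $[0,\infty)$, $\sup_n\tilde J_{k_n}(x)<\infty$ for $\mu_{-w}$-a.e. $x$; (A7) for all $\epsilon>0$,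 $\inf_{k\ge0}\mu_{-w}(K^{J_k}_\epsilon(0))>0$, where $\mu_{-w}(K^{J_k}_\epsilon(0)):=\mu_{-w}(\{x\in Y_k:B_k(x,x)\le\epsilon^2\})$ for any standard representation $(Y_k,B_k)$ of $J_k$. Effective average action. For $y\in\mathcal A(\mu)$ (then $y-w\in\mathcal H(\mu_{-w})$), $V_k^*(y):=\sup_{\phi\in X^*}\big[\phi(y)-\ln\int_X\exp[\phi]\,\mathrm d\mu_k\big]$ and $\Gamma_k(y):=V_k^*(y)-\frac12\underline{I_k}(y-w,y-w)$. Admissibility. For $y\in\mathcal A(\mu)$ and a standard representation $(Y,B)$ of $I_k$ (with respect to $\mu_{-w}$), $Y$ has full $\mu_{-y}$-measure and $\tilde I_k(x)=B(x,x)$ is well defined for $\mu_{-y}$-a.e. $x$. The point $y$ is admissible if $$\lim_{k\to\infty}\inf_{\phi\in X^*}\frac{\int_X\exp[\phi(x)-\frac12\tilde I_k(x)]\,\mathrm d\mu_{-y}(x)}{\int_X\exp[-\frac12\tilde I_k(x)]\,\mathrm d\mu_{-y}(x)}=1.$$ Generalised Onsager-Machlup function. For $a\in w+\mathcal H(\mu_{-w})$, $s>0$ and a standard representation $(Y_k,B_k)$ of $J_k$ put $\mu(K^{J_k}_s(a)):=\mu(\{x\in X:x-w\in Y_k,\ B_k(x-a,x-a)\le s^2\})$ (independent of the representation). Then $$\overline{\mathcal F}(a,b):=\lim_{(k,s)\to(\infty,0)}\ln\frac{\mu(K^{J_k}_s(a))}{\mu(K^{J_k}_s(b))}\in\overline{\mathbb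 R}$$ whenever this joint limit (with $s>0$) exists in $\overline{\mathbb R}$, with the conventions $\ln0=-\infty$, $\ln\infty=\infty$, $c/0=\infty$ for $c>0$, and $0/0$ undefined. *)

(* Defs.v *)
From HB Require Import structures.
From mathcomp Require Import all_boot all_order all_algebra.
From mathcomp Require Import all_classical all_reals all_analysis.
From mathcomp Require Import measurable_realfun.

Set Implicit Arguments.
Unset Strict Implicit.
Unset Printing Implicit Defensive.
Import Order.TTheory GRing.Theory Num.Theory.
Import numFieldNormedType.Exports.

Local Open Scope classical_set_scope.
Local Open Scope ring_scope.

(* The uniformity of a [tvsType] induces its topology but is not required to
   be translation invariant; Cauchy filters are therefore defined from the
   neighbourhoods of 0. *)
Definition tvs_cauchy (R : realType) (X : tvsType R) (F : set_system X) :=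
  forall U : set X, nbhs (0 : X) U ->
    exists2 A, F A & forall x y, A x -> A y -> U (x - y).

Definition tvs_bounded (R : realType) (X : tvsType R) (A : set X) :=
  forall U : set X, nbhs (0 : X) U ->
    exists2 s : R, 0 < s & forall t, s <= t -> A `<=` [set t *: u | u in U].

Definition quasicomplete (R : realType) (X : tvsType R) :=
  forall A : set X, tvs_bounded A -> closed A ->
    forall F : set_system X, ProperFilter F -> F A -> tvs_cauchy F ->
      exists2 x, A x & F --> x.

Record dual (R : realType) (X : tvsType R) := Dual {
  dual_fun :> {linear X -> R^o};
  dual_continuous : continuous dual_fun }.

Definition weakly_compact (R : realType) (X : tvsType R) (K : set X) :=
  @compact (initial_topology
    ((fun x phi => phi x) : X -> {ptws dual X -> R^o})) K.

Definition disk (R : realType) (X : tvsType R) (D : set X) :=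
  @convex_set R X D /\ forall (t : R) x, `|t| <= 1 -> D x -> D (t *: x).

Definition affine_subspace (R : realType) (X : tvsType R) (Y : set X) :=
  forall (t : R) x y, Y x -> Y y -> Y (t *: x + (1 - t) *: y).

Definition hereditarily_separable (T : topologicalType) (A : set T) :=
  forall S, S `<=` A -> exists D, [/\ countable D, D `<=` S & S `<=` closure D].

Definition pointed_tvs (R : realType) (X : tvsType R) : Type := X.
HB.instance Definition _ (R : realType) (X : tvsType R) :=
  Choice.on (pointed_tvs X).
HB.instance Definition _ (R : realType) (X : tvsType R) :=
  isPointed.Build (pointed_tvs X) (0 : X).

Notation borel X :=
  (g_sigma_algebraType (@open X : set (set (pointed_tvs X)))).

(* As in the library's [integral] and [almost_everywhere], measures enter the
   definitions below as set functions. *)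

Definition radon (R : realType) (X : tvsType R) (mu : set (borel X) -> \bar R) :=
  forall A : set (borel X), measurable A ->
    mu A = ereal_sup [set mu K | K in [set K : set X | compact K /\ K `<=` A]].

(* [translate mu z] is the measure written mu_{-z}. *)
Definition translate (R : realType) (X : tvsType R)
    (mu : set (borel X) -> \bar R) (z : X) : set (borel X) -> \bar R :=
  pushforward mu ((fun x : X => x - z) : borel X -> borel X).

(* The Radon extension of nu x nu to the Borel sigma-algebra of X * X. *)
Definition radon_square (R : realType) (X : tvsType R)
    (nu : set (borel X) -> \bar R)
    (nu2 : {measure set (borel (X * X)%type) -> \bar R}) :=
  radon nu2 /\ forall A B : set (borel X), measurable A -> measurable B ->
    nu2 (A `*` B) = (nu A * nu B)%E.

(* Measurability with respect to the completion of [mu]. *)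
Definition completion_measurable (R : realType) d (T : measurableType d)
    (mu : set T -> \bar R) (f : T -> \bar R) :=
  forall E : set (\bar R), measurable E -> completed_algebra_gen mu (f @^-1` E).

(* The sets involved are only measurable for the completion of [mu], hence
   the outer measure. *)
Definition cvg_in_measure (R : realType) d (T : measurableType d)
    (mu : set T -> \bar R) (g : nat -> T -> R) (f : T -> \bar R) :=
  forall e : R, 0 < e ->
    mu_ext mu [set x | (e%:E < `|(g n x)%:E - f x|)%E] @[n --> \oo] --> 0%E.

Definition lusin_affine (R : realType) (X : tvsType R)
    (nu : set (borel X) -> \bar R) (Y : set X) :=
  affine_subspace Y /\ forall e : R, 0 < e ->
    exists K : set X, [/\ @convex_set R X K, compact K, K `<=` Y &
      ((1 - e)%:E <= nu K)%E].

Definition lusin_linear (R : realType) (X : tvsType R)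
    (nu : set (borel X) -> \bar R) (Y : set X) := lusin_affine nu Y /\ Y 0.

Definition calA (R : realType) (X : tvsType R)
    (nu : set (borel X) -> \bar R) : set X :=
  \bigcap_(Y in lusin_affine nu) Y.

Definition calH (R : realType) (X : tvsType R)
    (nu : set (borel X) -> \bar R) : set X :=
  \bigcap_(Y in lusin_linear nu) Y.

Definition lusin_standard (R : realType) (X : tvsType R)
    (nu : set (borel X) -> \bar R) (Y : set X) :=
  lusin_linear nu Y /\ exists2 D : nat -> set X,
    forall n, compact (D n) /\ disk (D n) & Y = \bigcup_n D n.

(* Symmetric positive semidefinite bilinear forms on the subspace [Y]; the
   values of [B] outside of [Y * Y] are irrelevant. *)
Definition psd_form (R : realType) (X : tvsType R) (Y : set X)
    (B : X -> X -> R) :=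
  [/\ forall a x y z, Y x -> Y y -> Y z -> B (a *: x + y) z = a * B x z + B y z,
      forall x y, Y x -> Y y -> B x y = B y x &
      forall x, Y x -> 0 <= B x x].

Definition calI (R : realType) (X : tvsType R) (nu : set (borel X) -> \bar R)
    (nu2 : set (borel (X * X)%type) -> \bar R) (f : X * X -> \bar R) :=
  completion_measurable nu2 f /\
  exists B : nat -> X -> X -> R,
    [/\ forall n, psd_form setT (B n) /\
          continuous (fun p : X * X => B n p.1 p.2),
        forall m n x, (m <= n)%N -> B m x x <= B n x x,
        {ae nu, forall x : X, (ereal_sup (range (fun n => (B n x x)%:E)) < +oo)%E} &
        cvg_in_measure nu2 (fun n p => B n p.1 p.2) f].

Definition calI_le (R : realType) (X : tvsType R) (nu : set (borel X) -> \bar R)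
    (nu2 : set (borel (X * X)%type) -> \bar R) (f g : X * X -> \bar R) :=
  exists2 h, calI nu nu2 h & {ae nu2, forall p : X * X, (f p + h p)%E = g p}.

Definition standard_rep (R : realType) (X : tvsType R)
    (nu : set (borel X) -> \bar R) (nu2 : set (borel (X * X)%type) -> \bar R)
    (f : X * X -> \bar R) (Y : set X) (B : X -> X -> R) :=
  [/\ lusin_standard nu Y, psd_form Y B,
      forall K : set X, weakly_compact K -> @convex_set R X K -> K `<=` Y ->
        {within K `*` K, continuous (fun p : X * X => B p.1 p.2)} &
      {ae nu2, forall p : X * X, f p = (B p.1 p.2)%:E}].

(* The complexification of X^*: the pair [(phi, psi)] stands for phi + i psi,
   and complex numbers are given by their real and imaginary parts. *)
Definition cdual (R : realType) (X : tvsType R) : Type := (dual X * dual X)%type.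

Definition ceval (R : realType) (X : tvsType R) (om : cdual X) (x : X) : R * R :=
  (om.1 x, om.2 x).

Definition csqnorm (R : realType) (z : R * R) : R := z.1 ^+ 2 + z.2 ^+ 2.

Definition Xi (R : realType) (X : tvsType R) : set (set (cdual X)) :=
  <<s \bigcup_(x in [set: X])
        [set (fun om => ceval om x) @^-1` E | E in @measurable _ (R * R)%type] >>.

Definition L2C (R : realType) d (A : measurableType d)
    (kappa : set A -> \bar R) (g : A -> R * R) :=
  measurable_fun setT g /\ (\int[kappa]_a (csqnorm (g a))%:E < +oo)%E.

Definition dini_upper_right (R : realType) (g : R -> R) (k : R) : \bar R :=
  limf_esup (fun h => ((g (k + h) - g k) / h)%:E) (0 : R)^'+.

(* Q_k, for [B] the form of a standard representation of I_k. *)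
Definition Qf (R : realType) (X : tvsType R) (w : X) (B : X -> X -> R) (x : X)
  : R := B (x - w) (x - w).

(* Q'_k, for [om] the family omega^k over the measure space of [kappa]. *)
Definition Qf' (R : realType) (X : tvsType R) (w : X) d (A : measurableType d)
    (kappa : set A -> \bar R) (om : A -> cdual X) (x : X) : \bar R :=
  (\int[kappa]_a (csqnorm (ceval (om a) (x - w)%R))%:E)%E.

(* J_k = I_k / r_k ^ 2. *)
Definition Jf (R : realType) (X : tvsType R) (r : R) (f : X * X -> \bar R)
  : X * X -> \bar R := fun p => (f p * (r ^- 2)%:E)%E.

Definition tilted (R : realType) (X : tvsType R) (mu : set (borel X) -> \bar R)
    (Q : X -> R) : set (borel X) -> \bar R :=
  fun A => ((\int[mu]_x (expR (- Q x / 2))%:E)^-1 *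
            \int[mu]_(x in A) (expR (- Q x / 2))%:E)%E.

Definition log_laplace_conj (R : realType) (X : tvsType R)
    (m : set (borel X) -> \bar R) (y : X) : \bar R :=
  ereal_sup (range (fun phi : dual X =>
    ((phi y)%:E - lne (\int[m]_x (expR (phi x))%:E))%E)).

(* [B] is the form of a standard representation of I_k. *)
Definition average_action (R : realType) (X : tvsType R)
    (mu : set (borel X) -> \bar R) (w : X) (B : X -> X -> R) (y : X) : \bar R :=
  (log_laplace_conj (tilted mu (Qf w B)) y
   - (B (y - w)%R (y - w)%R / 2)%:E)%E.

Definition admissible (R : realType) (X : tvsType R)
    (mu : set (borel X) -> \bar R) (B : R -> X -> X -> R) (y : X) :=
  ereal_inf (range (fun phi : dual X =>
    (\int[translate mu y]_x (expR (phi x - B k x x / 2))%:E /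
     \int[translate mu y]_x (expR (- B k x x / 2))%:E)%E))
    @[k --> +oo%R] --> 1%E.

(* mu(K_s(a)) for the standard representation [(Y, B)]. *)
Definition ball_measure (R : realType) (X : tvsType R)
    (mu : set (borel X) -> \bar R) (w : X) (Y : set X) (B : X -> X -> R)
    (a : X) (s : R) : \bar R :=
  mu [set x : X | Y (x - w) /\ B (x - a) (x - a) <= s ^+ 2].

(* The generalised Onsager-Machlup function exists at [(a, b)] and equals [L].
   In [\bar R], c / 0 = +oo for c > 0, while 0 / 0 is excluded explicitly. *)
Definition onsager_machlup (R : realType) (X : tvsType R)
    (mu : set (borel X) -> \bar R) (w : X)
    (Y : R -> set X) (B : R -> X -> X -> R) (a b : X) (L : \bar R) :=
  (\forall k \near +oo%R & s \near (0 : R)^'+,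
     ~ (ball_measure mu w (Y k) (B k) a s = 0%E /\
        ball_measure mu w (Y k) (B k) b s = 0%E)) /\
  lne (ball_measure mu w (Y p.1) (B p.1) a p.2 /
       ball_measure mu w (Y p.1) (B p.1) b p.2)%E
    @[p --> filter_prod (pinfty_nbhs R) (0 : R)^'+] --> L.

(* Main.v *)
Require Import Defs.
From HB Require Import structures.
From mathcomp Require Import all_boot all_order all_algebra finmap.
From mathcomp Require Import all_classical all_reals all_analysis.
From mathcomp Require Import measurable_realfun.
From mathcomp Require Import ring lra.

(* Write u = x - w, nu = mu_{-w} and h = y - w.  Let B_n be the increasing continuous
   forms approximating I_k, and B the form of a standard representation.  By Egorov,
   B_n converges uniformly on compact convex sets K of almost full measure; there the
   continuous kernels B - B_n are small in measure, hence small everywhere on the square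
   of the support of nu restricted to K, so that B_n -> B at pairs of points of these
   supports.  For fixed x the points z with B_n(x,z) -> B(x,z) form a
   Lusin linear subspace, which therefore contains H(nu); using this twice yields
   B_n(u,u) -> B(u,u), B_n(u,h) -> B(u,h) for almost all u, and B_n(h,h) -> B(h,h).
   In particular the forms representing I_k and J_k are proportional wherever needed.

   Expanding B(u,u) around h turns the conjugate of log-Laplace into
   Gamma_k(y) = ln N_k - ln inf_phi int exp[phi - B(.,h) - B/2] d mu_{-y}.  Since
   B_n(.,h) is in X^* and dominated convergence applies (Cauchy-Schwarz bounds
   |B_n(.,h)| by the quadratic forms), the functional B(.,h) can be absorbed into phi,
   and admissibility gives Gamma_k(y) = ln(N_k / D_k) + o(1), where
   D_k = int exp[-B/2] d mu_{-y}.  By the layer-cake formula, N_k and D_k are averages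
   of the measures of the J_k-balls at w and y over radii that concentrate at 0 as
   r_k -> oo; (A7) makes the tails negligible, so ln(N_k / D_k) has the limit of the
   ratio of ball measures. *)

Set Implicit Arguments.
Unset Strict Implicit.
Unset Printing Implicit Defensive.

Import Order.TTheory GRing.Theory Num.Theory.
Import numFieldNormedType.Exports.

Local Open Scope classical_set_scope.
Local Open Scope ring_scope.

(** * Borel and Radon measures on a topological vector space *)

Lemma convex_setE (R : realType) (X : tvsType R) (K : set X) :
  @convex_set R X K <-> forall (t : R) x y, 0 <= t <= 1 -> K x -> K y ->
    K (t *: x + (1 - t) *: y).
Proof.
split=> [cK t x y t01 Kx Ky|cK x y l].
  have tI : Itv.spec (@Itv.num_sem R) (Itv.Real `[0%Z, 1%Z]) t.
    by apply/andP; split; [exact: num_real|rewrite /= in_itv/=].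
  have := cK x y (Itv.mk tI); rewrite !inE => /(_ Kx Ky) H; exact: H.
rewrite !inE => Kx Ky; apply: cK => //.
by apply/andP; split; [exact: ge0|exact: le1].
Qed.

Section BorelRadon.
Context (R : realType) (X : tvsType R) (X_hausdorff : hausdorff_space X).
Implicit Types (K : set X) (nu : {measure set (borel X) -> \bar R}).

Lemma open_borel (U : set X) : open U -> measurable (U : set (borel X)).
Proof. by move=> oU; apply: sub_sigma_algebra. Qed.

Lemma closed_borel (C : set X) : closed C -> measurable (C : set (borel X)).
Proof.
move=> cC; rewrite -[C]setCK; apply: measurableC; apply: open_borel.
exact: closed_openC.
Qed.

Lemma compact_borel K : compact K -> measurable (K : set (borel X)).
Proof. by move=> cK; apply: closed_borel; exact: compact_closed. Qed.

Lemma continuous_borel (f : X -> X) : continuous f ->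
  measurable_fun setT (f : borel X -> borel X).
Proof.
move=> cf; apply: (@measurability _ _ (borel X) (borel X) setT f (@open X) erefl).
move=> _ [V oV <-]; rewrite setTI; apply: open_borel.
by move/continuousP : cf; exact.
Qed.

Lemma within_continuous_borel (D : set X) (f : X -> R) :
  closed D -> {within D, continuous f} ->
  measurable_fun (D : set (borel X)) (f : borel X -> R).
Proof.
move=> cD /continuousP cf.
apply: (measurability _ (RGenOpens.measurableE R)).
move=> _ [_ [a [b ->]] <-].
have /cf/open_subspaceP[U oU UE] : open `]a, b[%classic by exact: interval_open.
rewrite setIC -UE; apply: measurableI; first exact: open_borel.
exact: closed_borel.
Qed.

Lemma continuous_borelR (f : X -> R) : continuous f ->
  measurable_fun setT (f : borel X -> R).
Proof.
move=> cf; apply: within_continuous_borel; first exact: closedT.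
exact: continuous_subspaceT.
Qed.

(** The topological support of the restriction of [nu] to [K], with its points taken in [K]. *)
Definition msupport nu K : set X :=
  [set x | K x /\ forall U, open U -> U x -> (0 < nu (K `&` U))%E].

Lemma msupport_closed nu K : compact K -> closed (msupport nu K).
Proof.
move=> cK x clx; split.
  have := compact_closed X_hausdorff cK; apply => V /clx[z [[Kz _] Vz]].
  by exists z.
move=> U oU Ux; have [z [[_ zK] Uz]] := clx U (open_nbhs_nbhs (conj oU Ux)).
exact: zK.
Qed.

(** A finite subcover bounds [K] by a finite union of null sets. *)
Lemma compact_locally_null nu K : compact K ->
  (forall x, K x -> exists U, [/\ open U, U x & nu (K `&` U) = 0%E]) ->
  nu K = 0%E.
Proof.
move=> cK null.
(* Cover compactness is phrased over pointed spaces; the origin serves as the point. *)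
pose hpX := isPointed.Build X 0.
pose Xp : ptopologicalType := HB.pack (Topological.sort X) hpX.
have : @cover_compact Xp K by rewrite -compact_cover.
have /choice[U UP] : forall x, exists U : set X, K x ->
    [/\ open U, U x & nu (K `&` U) = 0%E].
  move=> x; have [/null[U UP]|nKx] := pselect (K x); first by exists U.
  by exists set0.
move=> /(_ X K U)[i /UP[]//|x Kx|D DK KD].
  by exists x => //; have [] := UP x Kx.
suff : forall s : seq X, all (fun x => x \in K) s ->
    nu.-negligible (K `&` \bigcup_(x in [set` s]) U x).
  move=> /(_ (enum_fset D)) N; apply/negligibleP; first exact: compact_borel.
  apply: negligibleS (N _) => [x Kx|]; first by split=> //; exact: KD.
  by apply/allP => x /DK.
elim=> [_|x s IH /= /andP[xK /IH N]].
  rewrite (_ : [set` [::]] = set0) ?bigcup_set0 ?setI0; first exact: negligible_set0.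
  by apply/seteqP; split.
rewrite [X in bigcup X](_ : _ = x |` [set` s]); last first.
  apply/seteqP; split=> z /=; rewrite inE; first by move=> /predU1P.
  by case=> [->|->]; rewrite ?eqxx ?orbT.
rewrite bigcup_setU1 setIUr; apply: negligibleU => //.
have [oU Ux null0] := UP x (set_mem xK); apply/negligibleP => //.
by apply: measurableI; [exact: compact_borel|exact: open_borel].
Qed.

(** By inner regularity the rest of [K] is measured by its compact subsets, and each of these is
    locally null, hence null. *)
Lemma msupport_measure nu K : radon nu -> compact K ->
  nu (msupport nu K) = nu K.
Proof.
move=> rnu cK.
have mS : measurable (msupport nu K : set (borel X)).
  by apply: closed_borel; exact: msupport_closed.
have mK := compact_borel cK.
have SK : msupport nu K `<=` K by move=> x [].
rewrite -[in RHS](setDUK SK) measureU0//; first exact: measurableD.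
rewrite rnu; last exact: measurableD.
apply/eqP; rewrite eq_le; apply/andP; split; last first.
  by apply: ereal_sup_ubound; exists set0; [split=> //; exact: compact0|rewrite measure0].
apply: ge_ereal_sup => _ [Q [cQ QK] <-].
rewrite (@compact_locally_null nu Q)// => x Qx.
have [Kx nSx] := QK x Qx.
have [U [oU Ux]] : exists U, [/\ open U, U x & ~ (0 < nu (K `&` U))%E].
  by apply: contrapT => H; apply: nSx; split=> // U oU Ux; apply: contrapT => ?; apply: H; exists U.
move=> /negP; rewrite -leNgt => KU0; exists U; split => //.
apply/eqP; rewrite eq_le measure_ge0 andbT (le_trans _ KU0)// le_measure ?inE//.
- by apply: measurableI; [exact: compact_borel|exact: open_borel].
- by apply: measurableI => //; exact: open_borel.
- by move=> z [/QK[]].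
Qed.

Lemma sub_cst_continuous (w : X) : continuous (fun x : X => x - w).
Proof.
move=> x; apply: (@continuous_comp _ _ _ (fun x => (x, w)) (fun p : X * X => p.1 - p.2)).
  by apply: cvg_pair => /=; [exact: cvg_id|exact: cvg_cst].
exact: sub_continuous.
Qed.

(** [translate] is a bare set function; this packages it as a probability, so that measure theory
    applies to it. *)
Lemma translate_probability (mu : probability (borel X) R) (w : X) :
  {nu : probability (borel X) R | translate mu w = nu}.
Proof.
have mf := continuous_borel (@sub_cst_continuous w).
pose g : {mfun borel X >-> borel X} :=
  HB.pack ((fun x : X => x - w) : borel X -> borel X)
    (isMeasurableFun.Build _ _ _ _ _ mf).
by exists (distribution mu g).
Qed.

Lemma compact_image_continuous (T T' : topologicalType) (f : T -> T') (C : set T) :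
  continuous f -> compact C -> compact (f @` C).
Proof. by move=> cf; apply: continuous_compact; exact: continuous_subspaceT. Qed.

Lemma radon_translate (mu : {measure set (borel X) -> \bar R}) (w : X) : radon mu ->
  radon (translate mu w).
Proof.
move=> rmu C mC; rewrite /translate /pushforward rmu; last first.
  by rewrite -[X in measurable X]setTI; exact: (continuous_borel (@sub_cst_continuous w)).
congr ereal_sup; apply/seteqP; split => _ [Q [cQ QC] <-].
- exists [set x - w | x in Q].
    split; first by apply: compact_image_continuous => //; exact: sub_cst_continuous.
    by move=> _ [x /QC Cx <-].
  congr (mu _); apply/seteqP; split => [x [z Qz] /addIr <-//|x Qx]; by exists x.
- exists [set x + w | x in Q].
    split; last by move=> _ [x /QC Cx <-] /=; rewrite addrK.
    rewrite (_ : (fun x => _) = (fun x => x - (- w))); last by apply/funext => x; rewrite opprK.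
    by apply: compact_image_continuous => //; exact: sub_cst_continuous.
  congr (mu _); apply/seteqP; split => [_ [z Qz <-] /=|x Qx]; rewrite ?addrK//.
  by exists (x - w) => //; rewrite subrK.
Qed.

End BorelRadon.

(** * Positive semidefinite forms on linear subspaces *)

Lemma within_comp (T T' U : topologicalType) (D : set T) (D' : set T')
    (g : T -> T') (f : T' -> U) : continuous g -> (forall x, D x -> D' (g x)) ->
  {within D', continuous f} -> {within D, continuous (f \o g)}.
Proof.
move=> cg DD' /subspace_continuousP cf; apply/subspace_continuousP => x Dx.
apply: (@cvg_comp _ _ _ g f _ (within D' (nbhs (g x))));
  last by apply: cf; exact: DD'.
move=> A; rewrite /within/= => nA.
have : nbhs x (g @^-1` (fun z => D' z -> A z)) := cg x _ nA.
rewrite nbhs_simpl /=; apply: filterS => z /= H Dz; exact/H/DD'.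
Qed.

Definition linear_subset (R : realType) (X : tvsType R) (Y : set X) :=
  Y 0 /\ forall (a : R) x y, Y x -> Y y -> Y (a *: x + y).

Section LinearSubset.
Context (R : realType) (X : tvsType R).
Implicit Types (Y : set X) (B : X -> X -> R).

Lemma linear_subsetT : linear_subset (@setT X). Proof. by split. Qed.

Lemma linear_subsetZ {Y} (a : R) x : linear_subset Y -> Y x -> Y (a *: x).
Proof. by case=> Y0 YD Yx; rewrite -[_ *: _]addr0; exact: YD. Qed.

Lemma linear_subsetD {Y} x y : linear_subset Y -> Y x -> Y y -> Y (x + y).
Proof. by case=> Y0 YD Yx Yy; rewrite -[x]scale1r; exact: YD. Qed.

Lemma linear_subsetB {Y} x y : linear_subset Y -> Y x -> Y y -> Y (x - y).
Proof.
by case=> Y0 YD Yx Yy; rewrite addrC -[- y]scaleN1r; exact: YD.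
Qed.

Lemma lusin_linear_subset (nu : set (borel X) -> \bar R) Y :
  lusin_linear nu Y -> linear_subset Y.
Proof.
case=> -[aY _] Y0; split=> // a x y Yx Yy.
have YZ b z : Y z -> Y (b *: z).
  by move=> Yz; have := aY b z 0 Yz Y0; rewrite scaler0 addr0.
(* The midpoint of two multiples; a multiple is an affine combination with 0. *)
have -> : a *: x + y = 2^-1 *: ((2 * a) *: x) + (1 - 2^-1) *: (2 *: y).
  rewrite !scalerA; congr (_ *: _ + _); first by field.
  by rewrite -[LHS]scale1r; congr (_ *: _); field.
by apply: aY; exact: YZ.
Qed.

Section Form.
Context (Y : set X) (B : X -> X -> R) (lY : linear_subset Y) (pB : psd_form Y B).

Lemma psdDl x y z : Y x -> Y y -> Y z -> B (x + y) z = B x z + B y z.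
Proof. by move=> ? ? ?; rewrite -{1}[x]scale1r; case: pB => -> //; rewrite mul1r. Qed.

Lemma psd0l z : Y z -> B 0 z = 0.
Proof.
move=> Yz; have Y0 := lY.1; have := @psdDl 0 0 z Y0 Y0 Yz.
by rewrite addr0 => /eqP; rewrite -subr_eq0 opprD addNKr oppr_eq0 => /eqP.
Qed.

Lemma psdZl a x z : Y x -> Y z -> B (a *: x) z = a * B x z.
Proof.
move=> Yx Yz; rewrite -[a *: x]addr0; case: pB => -> // ; last exact: lY.1.
by rewrite psd0l// addr0.
Qed.

Lemma psdC x y : Y x -> Y y -> B x y = B y x. Proof. by case: pB => _ + _; exact. Qed.

Lemma psd_ge0 x : Y x -> 0 <= B x x. Proof. by case: pB => _ _; exact. Qed.

Lemma psdDr x y z : Y x -> Y y -> Y z -> B z (x + y) = B z x + B z y.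
Proof.
move=> Yx Yy Yz; rewrite psdC//; last exact: linear_subsetD.
by rewrite psdDl// !(@psdC z).
Qed.

Lemma psdZr a x z : Y x -> Y z -> B z (a *: x) = a * B z x.
Proof.
move=> Yx Yz; rewrite psdC//; last exact: linear_subsetZ.
by rewrite psdZl// (@psdC z).
Qed.

Lemma psd_line a x y : Y x -> Y y ->
  B (a *: x + y) (a *: x + y) = a ^+ 2 * B x x + 2 * a * B x y + B y y.
Proof.
move=> Yx Yy; have Yax : Y (a *: x) by exact: linear_subsetZ.
rewrite psdDl ?psdDr ?psdZl ?psdZr//; last exact: linear_subsetD.
by rewrite (@psdC y)//; ring.
Qed.

Lemma psdBB x y : Y x -> Y y ->
  B (x - y) (x - y) = B x x - 2 * B x y + B y y.
Proof.
by move=> Yx Yy; rewrite addrC -scaleN1r psd_line// (@psdC y)//; ring.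
Qed.

Lemma psdDD x y : Y x -> Y y ->
  B (x + y) (x + y) = B x x + 2 * B x y + B y y.
Proof.
by move=> Yx Yy; rewrite -{1 2}[x]scale1r psd_line//; ring.
Qed.

Lemma psdBl x y z : Y x -> Y y -> Y z -> B (x - y) z = B x z - B y z.
Proof.
move=> Yx Yy Yz; rewrite addrC -scaleN1r; case: pB => -> // _ _.
by rewrite mulN1r addrC.
Qed.

Lemma psd_cauchy_schwarz x y : Y x -> Y y -> B x y ^+ 2 <= B x x * B y y.
Proof.
move=> Yx Yy; have xx0 := psd_ge0 Yx; have yy0 := psd_ge0 Yy.
have line a : 0 <= a ^+ 2 * B x x + 2 * a * B x y + B y y.
  rewrite -psd_line//; apply: psd_ge0.
  by apply: linear_subsetD => //; exact: linear_subsetZ.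
have [xxE|xxN] := eqVneq (B x x) 0.
  rewrite xxE mul0r; have [->|xyN] := eqVneq (B x y) 0; first by rewrite expr0n.
  (* With [B x x = 0] the quadratic in [a] is affine, and this [a] gives it the value -1. *)
  have := line (- (B y y + 1) / (2 * B x y)); rewrite xxE mulr0 add0r.
  rewrite (_ : 2 * _ * _ = - (B y y + 1)); last by field.
  by move=> ?; exfalso; lra.
(* The minimiser of the quadratic. *)
have := line (- B x y / B x x).
rewrite (_ : _ + _ = (B x x * B y y - B x y ^+ 2) / B x x); last by field.
by rewrite pmulr_lge0 ?subr_ge0// invr_gt0 lt_neqAle eq_sym xxN.
Qed.

End Form.

Lemma psd_formB B B' : psd_form setT B -> psd_form setT B' ->
  (forall x, B' x x <= B x x) -> psd_form setT (fun x y => B x y - B' x y).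
Proof.
case=> [l s p] [l' s' p'] BB'; split=> [a x y z _ _ _|x y _ _|x _].
- by rewrite l// l'//; ring.
- by rewrite s// s'.
- by rewrite subr_ge0.
Qed.

Lemma psd_formZ Y B c : 0 <= c -> psd_form Y B ->
  psd_form Y (fun x y => c * B x y).
Proof.
move=> c0 [l s p]; split=> [a x y z Yx Yy Yz|x y Yx Yy|x Yx].
- by rewrite l//; ring.
- by rewrite s.
- by rewrite mulr_ge0// p.
Qed.

(** The identity into the weak topology is continuous. Standard representations are continuous on
    weakly compact sets, while Lusin subspaces supply compact ones. *)
Lemma compact_weakly_compact (K : set X) : compact K -> weakly_compact K.
Proof.
move=> cK; rewrite /weakly_compact.
set f := (fun x phi => phi x : R^o) : X -> {ptws dual X -> R^o}.
have cf : continuous f.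
  move=> x; apply/cvg_sup => phi U [V [[W oW <-] /= Wx WU]].
  rewrite nbhs_simpl /=; apply: filterS (_ : nbhs x (phi @^-1` W)) => [z Wz|].
    exact: WU.
  have := @dual_continuous _ _ phi x W (open_nbhs_nbhs (conj oW Wx)).
  by rewrite nbhs_simpl.
have cid : continuous (id : X -> initial_topology f).
  exact: continuous_comp_initial.
by have := compact_image_continuous cid cK; rewrite image_id.
Qed.

Lemma compact_convexD (E F : set X) : compact E -> compact F ->
  @convex_set R X E -> @convex_set R X F ->
  compact [set p.1 + p.2 | p in E `*` F] /\
  @convex_set R X [set p.1 + p.2 | p in E `*` F].
Proof.
move=> cE cF /convex_setE vE /convex_setE vF; split.
  by apply: compact_image_continuous; [exact: add_continuous|exact: compact_setX].
apply/convex_setE => t _ _ t01 [[a b] [/= Ea Fb] <-] [[a' b'] [/= Ea' Fb'] <-].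
exists (t *: a + (1 - t) *: a', t *: b + (1 - t) *: b').
  by split => /=; [exact: vE|exact: vF].
by rewrite /= !scalerDr addrACA.
Qed.

Lemma compact_convexN (E : set X) : compact E -> @convex_set R X E ->
  compact [set - x | x in E] /\ @convex_set R X [set - x | x in E].
Proof.
move=> cE /convex_setE vE; split.
  by apply: compact_image_continuous => //; exact: opp_continuous.
apply/convex_setE => t _ _ t01 [a Ea <-] [b Eb <-].
by exists (t *: a + (1 - t) *: b); [exact: vE|rewrite opprD !scalerN].
Qed.

Lemma convex_set1 (x : X) : @convex_set R X [set x].
Proof. by apply/convex_setE => t _ _ _ -> ->; rewrite -scalerDl subrKC scale1r. Qed.

(* Polarization reduces continuity on a product to the squares of the compact
   convex sets [E + F] and [E - F]. *)
Lemma form_continuous_setX (Y : set X) (B : X -> X -> R) (E F : set X) :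
  linear_subset Y -> psd_form Y B ->
  (forall K : set X, weakly_compact K -> @convex_set R X K -> K `<=` Y ->
     {within K `*` K, continuous (fun p : X * X => B p.1 p.2)}) ->
  compact E -> compact F -> @convex_set R X E -> @convex_set R X F ->
  E `<=` Y -> F `<=` Y ->
  {within E `*` F, continuous (fun p : X * X => B p.1 p.2)}.
Proof.
move=> lY pB cB cE cF vE vF EY FY.
have [cNF vNF] := compact_convexN cF vF.
have [cS vS] := compact_convexD cE cF vE vF.
have [cD vD] := compact_convexD cE cNF vE vNF.
have SY : [set p.1 + p.2 | p in E `*` F] `<=` Y.
  by move=> _ [[a b] [/= /EY ? /FY ?] <-]; exact: linear_subsetD.
have DY : [set p.1 + p.2 | p in E `*` [set - x | x in F]] `<=` Y.
  by move=> _ [[a _] [/= /EY ? [b /FY ? <-]] <-]; exact: linear_subsetB.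
have c1 : {within E `*` F, continuous
    ((fun p : X * X => B p.1 p.2) \o (fun p => (p.1 + p.2, p.1 + p.2)))}.
  apply: within_comp (cB _ (compact_weakly_compact cS) vS SY).
    by move=> p; apply: cvg_pair; exact: add_continuous.
  by move=> p Ep; split; exists p.
have c2 : {within E `*` F, continuous
    ((fun p : X * X => B p.1 p.2) \o (fun p => (p.1 - p.2, p.1 - p.2)))}.
  apply: within_comp (cB _ (compact_weakly_compact cD) vD DY).
    by move=> p; apply: cvg_pair; exact: sub_continuous.
  by move=> p [/= Ep Fp]; split; exists (p.1, - p.2) => //; split => //=; exists p.2.
move: c1 c2 => /subspace_continuousP c1 /subspace_continuousP c2.
have c3 : {within E `*` F, continuous (fun p : X * X =>
    (B (p.1 + p.2) (p.1 + p.2) - B (p.1 - p.2) (p.1 - p.2)) * 4^-1)}.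
  apply/subspace_continuousP => p Ep.
  by apply: cvgMl; apply: cvgB; [exact: c1|exact: c2].
apply: subspace_eq_continuous c3 => p /set_mem[/= /EY Y1 /FY Y2].
by rewrite /from_subspace (psdBB lY pB)// (psdDD lY pB)//; field.
Qed.

End LinearSubset.

(** * Convergence of the approximating forms *)

Section FormLimit.
Context (R : realType) (X : tvsType R) (X_hausdorff : hausdorff_space X).
Context (nu : {measure set (borel X) -> \bar R})
  (nu2 : {measure set (borel (X * X)%type) -> \bar R})
  (nu2X : forall A B : set (borel X), measurable A -> measurable B ->
     nu2 (A `*` B) = (nu A * nu B)%E).

(** The sigma-algebra is generated by the open sets of the product space, so the rectangle is
    written as a closed set intersected with an open one. *)
Lemma borel_setX (K1 K2 U1 U2 : set X) : compact K1 -> compact K2 ->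
  open U1 -> open U2 ->
  measurable ((K1 `&` U1) `*` (K2 `&` U2) : set (borel (X * X)%type)).
Proof.
move=> cK1 cK2 oU1 oU2.
have -> : (K1 `&` U1) `*` (K2 `&` U2) =
    ((fst @^-1` K1) `&` (snd @^-1` K2)) `&` ((fst @^-1` U1) `&` (snd @^-1` U2)).
  by apply/seteqP; split=> -[a b] /=; tauto.
apply: measurableI.
  apply: (@closed_borel R (X * X)%type).
  apply: closedI; apply: closed_comp => [? _|]; try exact: cvg_fst;
    try exact: cvg_snd; exact: compact_closed.
apply: (@open_borel R (X * X)%type).
apply: openI; apply: open_comp => //  ? _; [exact: cvg_fst|exact: cvg_snd].
Qed.

(* Where [C := B - Bn m] is continuous and larger than [4 e] at a point of the
   product of the supports, it stays larger than [3 e] on a product set of positive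
   measure, contradicting convergence in measure. *)
Lemma form_cvg_supports (f : X * X -> \bar R) (B : X -> X -> R)
    (Bn : nat -> X -> X -> R) (E1 E2 K1 K2 : set X) :
  compact K1 -> compact K2 -> K1 `<=` E1 -> K2 `<=` E2 ->
  {within E1 `*` E2, continuous (fun p : X * X => B p.1 p.2)} ->
  (forall n, continuous (fun p : X * X => Bn n p.1 p.2)) ->
  (forall e : R, 0 < e -> exists m, forall n, (m <= n)%N -> forall x z, K1 x -> K2 z ->
     `|Bn n x z - Bn m x z| <= e) ->
  cvg_in_measure nu2 (fun n p => Bn n p.1 p.2) f ->
  {ae nu2, forall p : X * X, f p = (B p.1 p.2)%:E} ->
  forall x z, msupport nu K1 x -> msupport nu K2 z ->
  Bn n x z @[n --> \oo] --> B x z.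
Proof.
move=> cK1 cK2 KE1 KE2 /subspace_continuousP cB cBn ucauchy fB [N [mN N0 NfB]] x z [K1x Sx] [K2z Sz].
apply/cvgrPdist_le => e e0; pose e' := e / 8.
have e'0 : 0 < e' by rewrite divr_gt0.
have [m mP] := ucauchy _ e'0.
(* The uniform Cauchy bound contributes one more [e'], and [5 * e'] is below [e]. *)
suff le4 : `|B x z - Bn m x z| <= 4 * e'.
  exists m => // n /= /mP/(_ _ _ K1x K2z) h.
  rewrite -[X in `|X|](subrKA (Bn m x z)) (le_trans (ler_normD _ _))//.
  by rewrite -(distrC (Bn n x z)) in h *; rewrite /e' in h le4; lra.
rewrite leNgt; apply/negP => gt4.
have : (fun p : X * X => B p.1 p.2 - Bn m p.1 p.2) @ within (E1 `*` E2) (nbhs (x, z)) -->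
    B x z - Bn m x z.
  apply: cvgB; first by apply: (cB (x, z)); split; [exact: KE1|exact: KE2].
  by apply: cvg_within_filter; exact: (cBn m (x, z)).
move=> /cvgrPdist_lt/(_ _ e'0); rewrite /within/= => -[[U V] /= [Ux Vz] UV].
pose A1 : set (borel X) := K1 `&` U^°; pose A2 : set (borel X) := K2 `&` V^°.
have mA1 : measurable A1.
  by apply: measurableI; [exact: compact_borel|by apply: open_borel; exact: open_interior].
have mA2 : measurable A2.
  by apply: measurableI; [exact: compact_borel|by apply: open_borel; exact: open_interior].
have p0 : (0 < nu2 (A1 `*` A2))%E.
  by rewrite nu2X// mule_gt0//; [apply: Sx|apply: Sz] => //; exact: open_interior.
have mA : measurable (A1 `*` A2 : set (borel (X * X)%type)).
  by apply: borel_setX => //; exact: open_interior.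
(* For large [n] the exceptional set of convergence in measure is too small to contain the rectangle
   [A1 * A2] up to a null set. *)
have [M _ MP] : \forall n \near \oo,
    (nu2^*%mu [set p : X * X | (e'%:E < `|(Bn n p.1 p.2)%:E - f p|)%E] < nu2 (A1 `*` A2))%E.
  exact: (fB _ e'0 _ (open_nbhs_nbhs (conj (@open_ereal_lt_ereal R _) p0))).
have := MP _ (leq_maxl M m); apply/negP; rewrite -leNgt.
(* Off [N], where [f] agrees with [B], the whole rectangle is shown to be exceptional at the index
   [maxn M m], which is the contradiction. *)
rewrite (measureDI nu2 mA mN) [X in (_ + X)%E](_ : _ = 0%E); last first.
  by apply: (subset_measure0 (measurableI _ _ mA mN) mN) => // p [].
rewrite adde0; apply: (@le_trans _ _ (nu2^*%mu (A1 `*` A2 `\` N))).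
  by rewrite measurable_mu_extE//; exact: measurableD.
apply: le_mu_ext.
move=> [a b] /= [[[K1a Ua] [K2b Vb]] nN].
have -> : f (a, b) = (B a b)%:E by apply: contrapT => /NfB.
have mn := mP _ (leq_maxr M m) _ _ K1a K2b.
have /= := UV (a, b) (conj (interior_subset Ua) (interior_subset Vb))
  (conj (KE1 _ K1a) (KE2 _ K2b)).
set Bk := Bn (maxn M m) in mn *; move=> gt1.
suff : e' < `|Bk a b - B a b| by rewrite -lte_fin.
have := ler_normD (B x z - Bn m x z - (B a b - Bn m a b)) (B a b - Bn m a b).
rewrite subrK => h1; have := ler_normD (B a b - Bk a b) (Bk a b - Bn m a b).
by rewrite subrKA => h2; rewrite -(distrC (B a b)); lra.
Qed.
End FormLimit.

Lemma norm_le_sqr (R : realType) (a e : R) : 0 <= e -> a ^+ 2 <= e ^+ 2 -> `|a| <= e.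
Proof. by move=> e0 ae; rewrite -(ger0_norm e0) -!sqrtr_sqr ler_wsqrtr. Qed.

(** * Lusin subspaces on which the approximating forms converge *)

Section Exhaustion.
Context (R : realType) (X : tvsType R) (X_hausdorff : hausdorff_space X).
Context (nu : probability (borel X) R) (nu_radon : radon nu).
Context (Bn : nat -> X -> X -> R)
  (pBn : forall n, psd_form setT (Bn n))
  (cBn : forall n, continuous (fun p : X * X => Bn n p.1 p.2))
  (ndBn : forall m n x, (m <= n)%N -> Bn m x x <= Bn n x x)
  (sBn : {ae nu, forall x : X, (ereal_sup (range (fun n => (Bn n x x)%:E)) < +oo)%E}).

(** Since [Bn n x x] is nondecreasing in [n], this is the domain of the limiting quadratic form. *)
Definition bounded_at (x : X) := exists M, forall n, Bn n x x <= M.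

(* [E] witnesses that the forms [B] below are continuous near [K]. *)
Definition uniform_part (Y E K : set X) :=
  [/\ compact K /\ @convex_set R X K, compact E /\ @convex_set R X E, E `<=` Y, K `<=` E &
   forall e : R, 0 < e -> exists m, forall n, (m <= n)%N ->
     forall z, K z -> Bn n z z - Bn m z z <= e].

Lemma diag_continuous n : continuous (fun z : X => Bn n z z).
Proof.
move=> z; apply: (@continuous_comp _ _ _ (fun z => (z, z)) (fun p : X * X => Bn n p.1 p.2)).
  by apply: cvg_pair => /=; exact: cvg_id.
exact: cBn.
Qed.

Lemma psd_diff m n : (m <= n)%N -> psd_form setT (fun x y => Bn n x y - Bn m x y).
Proof. by move=> mn; apply: psd_formB => // x; exact: ndBn. Qed.

(** The convexity defect of the quadratic form along a segment is [t * (1 - t) * P (x - z) (x - z)],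
    which is non-negative. *)
Lemma psd_sublevel_convex (P : X -> X -> R) (c : R) : psd_form setT P ->
  @convex_set R X [set z | P z z <= c].
Proof.
move=> pP; apply/convex_setE => t x z /andP[t0 t1] /= Px Pz.
have lT := @linear_subsetT R X.
rewrite (psd_line lT pP)// (psdZr lT pP)// (psdZr lT pP)// (psdZl lT pP)//.
have := psd_ge0 pP (x := x - z) Logic.I; rewrite (psdBB lT pP)// => xz.
suff : t * (1 - t) * (P x x - 2 * P x z + P z z) >= 0 /\ t * P x x + (1 - t) * P z z <= c.
  by move=> [h1 h2]; apply: le_trans h2; rewrite -subr_ge0 (le_trans h1)//;
    rewrite le_eqVlt; apply/orP; left; apply/eqP; ring.
split; first by rewrite !mulr_ge0// subr_ge0.
have -> : c = t * c + (1 - t) * c by ring.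
by rewrite lerD// ler_wpM2l// subr_ge0.
Qed.

(** Egorov's theorem gives uniform convergence off a small set [C], but [E] minus [C] need be
    neither compact nor convex. The estimates obtained there are therefore imposed on all of [E]:
    they are closed convex conditions, by [psd_sublevel_convex]. Half of [e] is lost to [E] and half
    to [C]. *)
Lemma uniform_part_ex (Y : set X) : lusin_linear nu Y -> forall e : R, 0 < e ->
  exists E K, uniform_part Y E K /\ ((1 - e)%:E <= nu K)%E.
Proof.
move=> [[_ /(_ _ _) lY] _] e e0; have e20 : 0 < e / 2 by rewrite divr_gt0.
have [E [vE cE EY nuE]] := lY _ e20.
have [N [mN N0 NP]] := sBn.
have mf n : measurable_fun (~` N : set (borel X)) ((fun z => Bn n z z) : borel X -> R).
  by apply: measurable_funTS; apply: continuous_borelR; exact: diag_continuous.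
pose g z := limn (fun n => Bn n z z).
have fg z : (~` N) z -> Bn n z z @[n --> \oo] --> g z.
  move=> Nz; apply: nondecreasing_is_cvgn; first by move=> m n; exact: ndBn.
  have sup_lt : (ereal_sup (range (fun n => (Bn n z z)%:E)) < +oo)%E.
    by apply: contrapT => ?; apply: Nz; exact: NP.
  exists (fine (ereal_sup (range (fun n => (Bn n z z)%:E)))) => _ [n _ <-].
  rewrite -lee_fin fineK; first by apply: ereal_sup_ubound; exists n.
  rewrite fin_numElt sup_lt andbT (@lt_le_trans _ _ (Bn 0%N z z)%:E)// ?ltNyr//.
  by apply: ereal_sup_ubound; exists 0%N.
have [C [mC nuC uC]] := pointwise_almost_uniform mf (measurableC mN)
  (le_lt_trans (probability_le1 nu (measurableC mN)) (ltry 1)) fg e20.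
have /choice[sg sgP] : forall i : nat, exists m, forall n, (m <= n)%N ->
    forall z, (~` N `\` C) z -> Bn n z z - Bn m z z <= i.+1%:R^-1.
  move=> i; have i0 : (0 : R) < i.+1%:R^-1 / 2 by rewrite divr_gt0.
  have : nbhs (g : {uniform` ~` N `\` C -> R})
      [set h | forall z, (~` N `\` C) z -> `|g z - h z| < i.+1%:R^-1 / 2].
    rewrite uniform_nbhs; exists [set xy | ball xy.1 (i.+1%:R^-1 / 2) xy.2].
    by split=> //; exact: (@entourage_ball R R (PosNum i0)).
  move=> /uC[m _ mP]; exists m => n mn z Cz.
  have := mP _ mn z Cz; have := mP _ (leqnn m) z Cz => /=.
  by rewrite !ltr_norml; move: (i.+1%:R^-1) => c /andP[? ?] /andP[? ?]; lra.
(* [sg] is the modulus of uniform convergence; [K] contains [E] minus [C] and [N]. *)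
pose K := E `&` \bigcap_i \bigcap_(n in [set n | (sg i <= n)%N])
  [set z | Bn n z z - Bn (sg i) z z <= i.+1%:R^-1].
have cK : compact K.
  apply: compact_closedI => //.
  apply: closed_bigI => i _; apply: closed_bigI => n _.
  apply: (closed_comp (f := fun z => Bn n z z - Bn (sg i) z z) _ (@closed_le _ _)) => z _.
  by apply: cvgB; exact: diag_continuous.
exists E, K; split.
  split=> //.
  - split=> //; apply/convex_setE => t x z t01 [Ex xP] [Ez zP]; split.
      by move/convex_setE : vE; exact.
    move=> i _ n ni.
    have /convex_setE := @psd_sublevel_convex _ i.+1%:R^-1 (psd_diff ni).
    by apply=> //; [exact: xP|exact: zP].
  - by move=> z [].
  - move=> eps eps0; have [i _ /(_ i (leqnn _)) ieps] := near_infty_natSinv_lt (PosNum eps0).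
    exists (sg i) => n ni z [_ /(_ i Logic.I n ni)] /= h.
    exact: le_trans h (ltW ieps).
have mE := compact_borel X_hausdorff cE; have mK := compact_borel X_hausdorff cK.
have mNC : measurable (C `|` N) by exact: measurableU.
have : (nu E <= nu K + nu C)%E.
  rewrite (measureDI nu mE mNC); apply: leeD.
    apply: le_measure; rewrite ?inE//; first exact: measurableD.
    move=> z [Ez /not_orP[nC nN]]; split=> // i _ n ni; exact: sgP.
  rewrite -(measureU0 mC mN N0); apply: le_measure; rewrite ?inE//.
  exact: measurableI.
move=> h.
have nuC' : fine (nu C) < e / 2.
  by rewrite -lte_fin fineK//; exact: fin_num_measure.
have := le_trans nuE h.
rewrite -(fineK (fin_num_measure nu _ mC)) -(fineK (fin_num_measure nu _ mK)).
by rewrite -EFinD !lee_fin; lra.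
Qed.

(** Cauchy-Schwarz for the form [Bn n - Bn m]: its diagonal is bounded by [|M| + 1] at the fixed
    point [x] and is uniformly small on [K]. *)
Lemma psd_diff_le (Y E K : set X) x M : uniform_part Y E K -> (forall n, Bn n x x <= M) ->
  forall e : R, 0 < e -> exists m, forall n, (m <= n)%N -> forall z, K z ->
    `|Bn n x z - Bn m x z| <= e.
Proof.
move=> [_ _ _ _ uK] xM e e0.
have M0 : 0 < `|M| + 1 by rewrite ltr_pwDr.
have [m mP] := uK _ (divr_gt0 (exprn_gt0 2 e0) M0); exists m => n mn z Kz.
have lT := @linear_subsetT R X; have pP := psd_diff mn.
apply: norm_le_sqr; first exact: ltW.
apply: le_trans (psd_cauchy_schwarz lT pP _ _) _ => //.
have P0 : 0 <= Bn n z z - Bn m z z by exact: (psd_ge0 pP).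
have Px : Bn n x x - Bn m x x <= `|M| + 1.
  have := psd_ge0 (pBn m) (x := x) Logic.I; have := xM n; have := ler_norm M; lra.
rewrite (le_trans (ler_wpM2r P0 Px))// -ler_pdivlMl// mulrC.
exact: mP.
Qed.

Lemma uniform_part_bounded (Y E K : set X) x : uniform_part Y E K -> K x ->
  bounded_at x.
Proof.
move=> [_ _ _ _ uK] Kx; have [m mP] := uK _ ltr01.
exists (Bn m x x + 1) => n; have [mn|/ltnW nm] := leqP m n.
  by have := mP _ mn _ Kx; lra.
by rewrite (le_trans (ndBn x nm))// lerDl.
Qed.

Lemma bounded_at_linear : linear_subset bounded_at.
Proof.
have lT := @linear_subsetT R X; split.
  by exists 0 => n; rewrite (psd0l lT (pBn n)).
(* The parallelogram inequality: the form at a sum is at most twice the sum of its two values. *)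
move=> a x z [M xM] [M' zM']; exists (2 * (a ^+ 2 * M) + 2 * M') => n.
have lt := @psd_ge0 _ _ _ _ (pBn n) (a *: x - z) Logic.I.
rewrite (psdBB lT (pBn n))// in lt; rewrite (psdDD lT (pBn n))//.
rewrite (psdZr lT (pBn n))// (psdZl lT (pBn n))// in lt *.
have := ler_wpM2l (sqr_ge0 a) (xM n); have := zM' n; lra.
Qed.

Context (Y : set X) (Y_lusin : lusin_linear nu Y).
Let lY : linear_subset Y := lusin_linear_subset Y_lusin.

(** Points of [calH nu] lie in every Lusin linear subspace; this one makes the approximating forms
    bounded at them. *)
Lemma lusin_linear_bounded : lusin_linear nu [set z | Y z /\ bounded_at z].
Proof.
have [b0 bD] := bounded_at_linear; have [Y0 YD] := lY.
split; last by [].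
split=> [t x z [Yx bx] [Yz bz]|e e0].
  by split; [apply: YD => //; exact: linear_subsetZ|apply: bD => //; exact: linear_subsetZ bounded_at_linear _].
have [E [K [uK nuK]]] := uniform_part_ex Y_lusin e0; exists K.
have [[cK vK] _ EY KE _] := uK; split=> // z Kz; split; first exact/EY/KE.
exact: uniform_part_bounded uK Kz.
Qed.

Context (nu2 : {measure set (borel (X * X)%type) -> \bar R})
  (nu2X : forall A B : set (borel X), measurable A -> measurable B ->
     nu2 (A `*` B) = (nu A * nu B)%E).
Context (f : X * X -> \bar R) (B : X -> X -> R) (pB : psd_form Y B)
  (cB : forall K : set X, weakly_compact K -> @convex_set R X K -> K `<=` Y ->
     {within K `*` K, continuous (fun p : X * X => B p.1 p.2)})
  (fBn : cvg_in_measure nu2 (fun n p => Bn n p.1 p.2) f)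
  (fB : {ae nu2, forall p : X * X, f p = (B p.1 p.2)%:E}).

Definition cvg_slice (x : X) : set X := [set z | Y z /\ Bn n x z @[n --> \oo] --> B x z].

(** The slice is linear because limits are. Its trace on [K] is closed by the estimate of
    [psd_diff_le], uniform in [z], hence compact; it contains [msupport nu K], which has the full
    measure of [K]. *)
Lemma cvg_slice_lusin x : Y x -> bounded_at x ->
  (forall E K, uniform_part Y E K -> msupport nu K `<=` cvg_slice x) ->
  lusin_linear nu (cvg_slice x).
Proof.
move=> Yx [M xM] suppS.
have sliceC t z z' : cvg_slice x z -> cvg_slice x z' -> cvg_slice x (t *: z + (1 - t) *: z').
  move=> [Yz cz] [Yz' cz'].
  have Ytz : Y (t *: z) by exact: linear_subsetZ.
  have Ytz' : Y ((1 - t) *: z') by exact: linear_subsetZ.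
  split; first exact: linear_subsetD.
  have lT := @linear_subsetT R X.
  rewrite (psdDr lY pB)// !(psdZr lY pB)//.
  under eq_fun do rewrite (psdDr lT (pBn _))// !(psdZr lT (pBn _))//.
  by apply: cvgD; apply: cvgMr.
split; last first.
  split; first exact: lY.1.
  rewrite (psdC pB)//; last exact: lY.1.
  rewrite (psd0l lY pB)//; under eq_fun do rewrite (psdC (pBn _))// (psd0l (@linear_subsetT R X) (pBn _))//.
  exact: cvg_cst.
split=> // e e0.
have [E [K [uK nuK]]] := uniform_part_ex Y_lusin e0.
have [[cK vK] [cE vE] EY KE _] := uK.
have clK := compact_closed X_hausdorff cK.
exists (K `&` cvg_slice x).
have cKS : compact (K `&` cvg_slice x).
  apply: (subclosed_compact _ cK) => [z clz|z []//].
  have Kz : K z by apply: clK => V /clz[z' [[Kz' _] Vz']]; exists z'.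
  split=> //; split; first exact/EY/KE.
  apply/cvgrPdist_le => eps eps0; have eps4 : 0 < eps / 4 by rewrite divr_gt0.
  have [m mP] := psd_diff_le uK xM eps4.
  have cx : {within E, continuous ((fun p : X * X => B p.1 p.2) \o (fun z => (x, z)))}.
    apply: (@within_comp _ _ _ _ ([set x] `*` E)).
    - by move=> z'; apply: cvg_pair => /=; [exact: cvg_cst|exact: cvg_id].
    - by move=> z' Ez'; split.
    - apply: (form_continuous_setX lY pB cB) => //; first exact: compact_set1.
        exact: convex_set1.
      by move=> _ ->.
  move/subspace_continuousP : cx => cx.
  have : (fun z => B x z - Bn m x z) @ within E (nbhs z) --> B x z - Bn m x z.
    apply: cvgB; first exact: (cx z (KE _ Kz)).
    apply: cvg_within_filter.
    apply: (@continuous_comp _ _ _ (fun z => (x, z)) (fun p : X * X => Bn m p.1 p.2)); last exact: cBn.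
    by apply: cvg_pair => /=; [exact: cvg_cst|exact: cvg_id].
  move=> /cvgrPdist_lt/(_ _ eps4); rewrite near_withinE => near_z.
  have [z' [[Kz' [_ /cvgrPdist_lt/(_ _ eps4)[m' _ m'P]]] /(_ (KE _ Kz')) h1]] := clz _ near_z.
  have h2 := m'P _ (leq_maxr m m'); have h3 := mP _ (leq_maxl m m') _ Kz'.
  (* Four quarters of [eps]: from [Bn n] to [Bn m] at [z], from [z] to the nearby slice point [z']
     for [B - Bn m], and at [z'] from [Bn m] through a later index to [B]. *)
  exists m => // n /= /mP/(_ _ Kz).
  move: h1 h2 h3; rewrite !ltr_norml !ler_norml => /andP[? ?] /andP[? ?] /andP[? ?] /andP[? ?].
  by apply/andP; split; lra.
split=> //.
- apply/convex_setE => t z z' t01 [Kz Sz] [Kz' Sz']; split; last exact: sliceC.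
  by move/convex_setE : vK; exact.
- rewrite (le_trans nuK)// -(msupport_measure X_hausdorff nu_radon cK) le_measure ?inE//.
  + by apply: closed_borel; exact: msupport_closed.
  + exact: compact_borel.
  + by move=> z Sz; split; [case: Sz|exact: suppS uK _ Sz].
Qed.

Definition supports : set X := [set x | exists E K, uniform_part Y E K /\ msupport nu K x].

(** Supplies the uniform Cauchy hypothesis of [form_cvg_supports]: by Cauchy-Schwarz the mixed
    difference squared is at most the product of two diagonal differences, each at most [e]. *)
Lemma cvg_supports x z : supports x -> supports z -> Bn n x z @[n --> \oo] --> B x z.
Proof.
move=> [E1 [K1 [u1 Sx]]] [E2 [K2 [u2 Sz]]].
have [[cK1 vK1] [cE1 vE1] EY1 KE1 uK1] := u1.
have [[cK2 vK2] [cE2 vE2] EY2 KE2 uK2] := u2.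
apply: (form_cvg_supports X_hausdorff nu2X cK1 cK2 KE1 KE2 _ cBn _ fBn fB Sx Sz).
  exact: (form_continuous_setX lY pB cB).
move=> e e0; have [m1 P1] := uK1 _ e0; have [m2 P2] := uK2 _ e0.
exists (maxn m1 m2) => n; rewrite geq_max => /andP[m1n m2n] x' z' K1x K2z.
have lT := @linear_subsetT R X.
have mn : (maxn m1 m2 <= n)%N by rewrite geq_max m1n.
have pP := psd_diff mn.
have le1 := P1 _ m1n _ K1x; have le2 := P2 _ m2n _ K2z.
have Bm1 := ndBn x' (leq_maxl m1 m2); have Bm2 := ndBn z' (leq_maxr m1 m2).
apply: norm_le_sqr; first exact: ltW.
apply: le_trans (psd_cauchy_schwarz lT pP _ _) _ => //.
by rewrite expr2 ler_pM ?(psd_ge0 pP)//; lra.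
Qed.

(** Countably many uniform parts, of measures tending to 1, suffice, since the support of each
    carries its measure. *)
Lemma ae_supports : {ae nu, forall x : X, supports x}.
Proof.
have /choice[EK EKP] : forall j : nat, exists EK : set X * set X,
    uniform_part Y EK.1 EK.2 /\ ((1 - j.+1%:R^-1)%:E <= nu EK.2)%E.
  move=> j; have j0 : (0 : R) < j.+1%:R^-1 by rewrite invr_gt0.
  by have [E [K EK]] := uniform_part_ex Y_lusin j0; exists (E, K).
pose S j : set (borel X) := msupport nu (EK j).2.
have cK j : compact (EK j).2 by have [[[]]] := EKP j.
have mS j : measurable (S j) by apply: closed_borel; exact: msupport_closed.
exists (~` \bigcup_j S j); split.
- by apply: measurableC; exact: bigcupT_measurable.
- rewrite probability_setC; last exact: bigcupT_measurable.
  suff -> : nu (\bigcup_j S j) = 1%E by rewrite subee.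
  apply/eqP; rewrite eq_le probability_le1 ?andbT; last exact: bigcupT_measurable.
  apply/lee_addgt0Pr => e e0.
  have [j _ /(_ j (leqnn _)) je] := near_infty_natSinv_lt (PosNum e0).
  have : ((1 - e)%:E <= nu (\bigcup_j S j))%E.
    apply: (@le_trans _ _ (nu (S j))).
      rewrite /S (msupport_measure X_hausdorff nu_radon (cK j)).
      have [_ +] := EKP j; apply: le_trans.
      by rewrite lee_fin lerD2l lerN2 ltW.
    rewrite le_measure ?inE//; first exact: bigcupT_measurable.
    exact: bigcup_sup.
  by rewrite EFinB leeBlDr.
- move=> x /= nx [j _ Sx]; apply: nx; exists (EK j).1, (EK j).2.
  by have [] := EKP j.
Qed.

Lemma calH_lusin (Z : set X) h : calH nu h -> lusin_linear nu Z -> Z h.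
Proof. by move=> Hh lZ; exact: Hh. Qed.

Lemma supports_slice x : Y x -> bounded_at x -> supports `<=` cvg_slice x ->
  calH nu `<=` cvg_slice x.
Proof.
move=> Yx bx Sx h Hh; apply: calH_lusin Hh _; apply: cvg_slice_lusin => // E K uK z Sz.
by apply: Sx; exists E, K.
Qed.

Lemma supports_sub x : supports x -> Y x /\ bounded_at x.
Proof.
move=> [E [K [uK [Kx _]]]]; split; last exact: uniform_part_bounded uK Kx.
by have [_ _ EY KE _] := uK; exact/EY/KE.
Qed.

(** The slice argument is run twice. First [x] is a support point, and its slice contains [calH nu].
    By symmetry the slice of [h] then contains all support points, so it is a Lusin linear subspace
    and contains [h] itself. *)
Lemma form_limit h : calH nu h ->
  [/\ Y h, Bn n h h @[n --> \oo] --> B h h &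
   {ae nu, forall u : X, [/\ Y u, Bn n u u @[n --> \oo] --> B u u &
      Bn n u h @[n --> \oo] --> B u h]}].
Proof.
move=> Hh; have [Yh bh] := calH_lusin Hh lusin_linear_bounded.
have slice x z : supports x -> calH nu z -> cvg_slice x z.
  move=> Sx; have [Yx bx] := supports_sub Sx; apply: supports_slice => // z' Sz'.
  by split; [case: (supports_sub Sz')|exact: cvg_supports].
have [_ hh] : cvg_slice h h.
  apply: (supports_slice Yh bh) => // x Sx.
  have [Yx _] := supports_sub Sx; have [_] := slice _ _ Sx Hh.
  rewrite (psdC pB)//; under eq_fun do rewrite (psdC (pBn _))//.
  by [].
split=> //; have [N [mN N0 NP]] := ae_supports; exists N; split=> // u nu_.
apply: NP => Su; apply: nu_; have [Yu _] := supports_sub Su.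
by split=> //; [exact: cvg_supports|case: (slice _ _ Su Hh)].
Qed.

End Exhaustion.

(** * Integrals *)

Section Integrals.
Context (R : realType) d (T : measurableType d) (mu : {measure set T -> \bar R}).
Local Open Scope ereal_scope.
Import HBNNSimple.

(* Discards the junk values that forms take outside of their Lusin subspace. *)
Lemma ge0_integral_full (D A : set T) (f : T -> \bar R) : measurable D ->
  mu (~` D) = 0 -> (forall x, 0 <= f x) ->
  \int[mu]_(x in A) f x = \int[mu]_(x in A `&` D) f x.
Proof.
move=> mD D0 f0; rewrite !(integral_mkcond (_ `&` _)) (integral_mkcond A).
have fA0 (B : set T) x : 0 <= (f \_ B) x by rewrite patchE; case: ifP.
rewrite !ge0_integralTE//; apply/eqP; rewrite eq_le; apply/andP; split.
  (* [f] may be non-measurable, so the simple functions below it are compared: cutting one down to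
     [D] keeps its integral. *)
  apply: ge_ereal_sup => _ [h hf <-]; apply: ereal_sup_ubound.
  exists (proj_nnsfun h mD) => [x|]; last first.
    rewrite -!integralT_nnsfun; apply: ge0_ae_eq_integral => //.
    - exact/measurable_EFinP/measurable_funP.
    - exact/measurable_EFinP/measurable_funP.
    - by move=> x _; rewrite lee_fin.
    - by move=> x _; rewrite lee_fin.
    exists (~` D); split=> //; first exact: measurableC.
    move=> x /= hx Dx; apply: hx => _.
    by rewrite /= mindicE mem_set// mulr1.
  rewrite /= mindicE patchE; have [Dx|nDx] := boolP (x \in D); last by rewrite mulr0; case: ifP.
  rewrite mulr1 in_setI Dx andbT; have := hf x.
  by rewrite patchE.
apply: ereal_sup_le => _ [h hf <-]; exists h => // x; apply: le_trans (hf x) _.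
by rewrite !patchE in_setI; case: (x \in A) => //=; case: (x \in D).
Qed.

(** On indicators this is the formula for [m]; linearity gives simple functions and monotone
    convergence gives [g]. *)
Lemma integral_density (F : T -> R) (m : {measure set T -> \bar R}) (g : T -> \bar R) :
  measurable_fun setT F -> (forall x, (0 <= F x)%R) ->
  (forall A, measurable A -> m A = \int[mu]_(x in A) (F x)%:E) ->
  measurable_fun setT g -> (forall x, 0 <= g x) ->
  \int[m]_x g x = \int[mu]_x (g x * (F x)%:E).
Proof.
move=> mF F0 mE mg g0; pose h := nnsfun_approx measurableT mg.
have mFE : measurable_fun setT (fun x => (F x)%:E) by exact/measurable_EFinP.
have mh n : measurable_fun setT (fun x => (h n x)%:E).
  exact/measurable_EFinP/measurable_funP.
have gh x : (h n x)%:E @[n --> \oo] --> g x.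
  by apply: cvg_nnsfun_approx.
have ndh x : {homo (fun n => (h n x)%:E) : a b / (a <= b)%N >-> a <= b}.
  by move=> a b ab; rewrite lee_fin; exact/lefP/nd_nnsfun_approx.
transitivity (limn (fun n => \int[m]_x (h n x)%:E)).
  rewrite -monotone_convergence//.
  - by apply: eq_integral => x _; apply/esym/cvg_lim.
  - by move=> n x _; rewrite lee_fin.
transitivity (limn (fun n => \int[mu]_x ((h n x)%:E * (F x)%:E))); last first.
  rewrite -monotone_convergence//.
  - apply: eq_integral => x _; apply/cvg_lim => //.
    by apply: cvgeZr.
  - by move=> n; exact: emeasurable_funM.
  - by move=> n x _; rewrite mule_ge0// lee_fin.
  - by move=> x _ a b ab; rewrite lee_wpmul2r ?lee_fin//; have := ndh x _ _ ab; rewrite lee_fin.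
congr (limn _); apply/funext => n.
have hE x : (h n x)%:E = \sum_(k \in range (h n)) (k * \1_(h n @^-1` [set k]) x)%:E.
  by rewrite fimfunE -fsumEFin.
have hFE x : (h n x)%:E * (F x)%:E =
    \sum_(k \in range (h n)) ((k * \1_(h n @^-1` [set k]) x)%:E * (F x)%:E).
  by rewrite hE ge0_mule_fsuml// => k; exact: nnfun_muleindic_ge0.
under eq_integral do rewrite hE; under [RHS]eq_integral do rewrite hFE.
have mk k : measurable_fun setT (fun x => (k * \1_(h n @^-1` [set k]) x)%:E).
  by apply/measurable_EFinP; exact: measurable_funM.
rewrite ge0_integral_fsum//; last first.
  by move=> k x _; exact: nnfun_muleindic_ge0.
rewrite ge0_integral_fsum//; last 2 first.
- by move=> k; exact: emeasurable_funM.
- by move=> k x _; rewrite mule_ge0 ?lee_fin//; exact: nnfun_muleindic_ge0.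
apply: eq_fsbigr => k /set_mem[t _ <-]; set S := _ @^-1` _.
have mS : measurable S by exact: measurable_funPTI.
under eq_integral do rewrite EFinM.
have m1 : measurable_fun setT (fun x => (\1_S x)%:E : \bar R).
  by apply/measurable_EFinP; exact: measurable_indic.
have k0 : 0 <= (h n t)%:E by rewrite lee_fin.
rewrite ge0_integralZl// integral_indic// setIT mE//.
under [RHS]eq_integral do rewrite EFinM -muleA.
rewrite ge0_integralZl//; last 2 first.
- exact: emeasurable_funM.
- by move=> x _; rewrite mule_ge0// lee_fin.
congr (_ * _); rewrite integral_mkcond; apply: eq_integral => x _.
rewrite patchE indicE; case: (x \in S); by rewrite ?mul1e ?mul0e.
Qed.

End Integrals.

(** * Layer-cake comparison of exponential integrals *)

Section LayerCake.
Context (R : realType) d (T : measurableType d) (P : probability T R).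
Local Open Scope ereal_scope.

(** Balls are closed sublevel sets, but the layer-cake formula produces open ones; these are
    exhausted by closed ones from inside. *)
Lemma measure_sublevel_lt (D : set T) (f g : T -> R) (C a : R) : measurable D ->
  measurable_fun D f -> measurable_fun D g -> (0 <= C)%R -> (0 < a)%R ->
  (forall t : R, (0 < t < a)%R ->
     P (D `&` [set x | (f x <= t)%R]) <= C%:E * P (D `&` [set x | (g x <= t)%R])) ->
  P (D `&` [set x | (f x < a)%R]) <= C%:E * P (D `&` [set x | (g x < a)%R]).
Proof.
move=> mD mf mg C0 a0 le_fg.
have mle (h : T -> R) (t : R) : measurable_fun D h -> measurable (D `&` [set x | (h x <= t)%R]).
  by move=> mh; rewrite -[X in D `&` X]/(h @^-1` [set y | (y <= t)%R]) -set_itvNyc; exact: mh.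
have mlt (h : T -> R) (t : R) : measurable_fun D h -> measurable (D `&` [set x | (h x < t)%R]).
  by move=> mh; rewrite -[X in D `&` X]/(h @^-1` [set y | (y < t)%R]) -set_itvNyo; exact: mh.
(* The shift by 2 keeps [b 0] positive. *)
pose b (n : nat) := (a - a / n.+2%:R)%R.
have b_itv n : (0 < b n < a)%R.
  rewrite /b subr_gt0 gtrBl divr_gt0// andbT ltr_pdivrMr// ltr_pMr// ltr1n//.
have bnd : {homo b : m n / (m <= n)%N >-> (m <= n)%R}.
  by move=> m n mn; rewrite lerD2l lerN2 ler_wpM2l ?(ltW a0)// lef_pV2 ?posrE// ler_nat.
have fE : D `&` [set x | (f x < a)%R] = \bigcup_n (D `&` [set x | (f x <= b n)%R]).
  apply/seteqP; split => [x [Dx fa]|x [n _ [Dx fb]]]; last first.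
    by split=> //=; have /andP[_] := b_itv n; exact: le_lt_trans.
  have d0 : (0 < (a - f x) / a)%R by rewrite divr_gt0// subr_gt0.
  have [n _ /(_ n.+1 (leqnSn _)) nd] := near_infty_natSinv_lt (PosNum d0).
  exists n => //; split=> //=; rewrite /b lerBrDr addrC -lerBrDr.
  by move: nd => /ltW /=; rewrite ler_pdivlMr// mulrC.
rewrite fE; have mF n : measurable (D `&` [set x | (f x <= b n)%R]) by exact: mle.
have cF : (P \o (fun n => D `&` [set x | (f x <= b n)%R])) n @[n --> \oo] -->
    P (\bigcup_n (D `&` [set x | (f x <= b n)%R])).
  apply: nondecreasing_cvg_mu => //; first exact: bigcupT_measurable.
  move=> m n mn; apply/subsetPset => x [Dx fx]; split=> //=.
  exact: le_trans fx (bnd _ _ mn).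
rewrite -(cvg_lim (@ereal_hausdorff R) cF); apply: lime_le.
  by apply/cvg_ex; eexists; exact: cF.
apply: nearW => n /=; apply: le_trans (le_fg _ (b_itv n)) _.
rewrite lee_wpmul2l ?lee_fin// le_measure ?inE//; [exact: mle|exact: mlt|].
by move=> x [Dx gx]; split=> //=; have /andP[_] := b_itv n; exact: le_lt_trans.
Qed.

(** Each integral is that of [P (expR (- rho * f) > t)] over [t >= 0], and a level [t] corresponds
    to the sublevel [f < - ln t / rho]. Levels above [expR (- rho * a)] meet the assumed comparison;
    those below contribute at most their length. *)
Lemma integral_expR_le (D : set T) (f g : T -> R) (C a rho : R) : measurable D ->
  measurable_fun D f -> measurable_fun D g -> (forall x, D x -> (0 <= f x)%R) ->
  (0 <= C)%R -> (0 < a)%R -> (0 < rho)%R ->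
  (forall t : R, (0 < t < a)%R ->
     P (D `&` [set x | (f x <= t)%R]) <= C%:E * P (D `&` [set x | (g x <= t)%R])) ->
  \int[P]_(x in D) (expR (- rho * f x))%:E <=
    C%:E * \int[P]_(x in D) (expR (- rho * g x))%:E + (expR (- rho * a))%:E.
Proof.
move=> mD mf mg f0 C0 a0 rho0 le_fg.
(* Being 0 off [D], this variable exceeds a positive level only inside [D]. *)
pose Z (h : T -> R) := ((fun x => expR (- rho * h x)) \_ D : T -> R).
have mZ (h : T -> R) : measurable_fun D h -> measurable_fun setT (Z h).
  move=> mh; apply/(measurable_restrictT _ mD).
  apply: measurableT_comp => //; exact: measurable_funM.
have Z0 h x : (0 <= Z h x)%R by rewrite /Z patchE; case: ifP => // _; exact: expR_ge0.
pose RVZ (h : T -> R) (mh : measurable_fun D h) : {RV P >-> R} :=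
  HB.pack (Z h) (isMeasurableFun.Build _ _ _ _ _ (mZ h mh)).
have EZ (h : T -> R) (mh : measurable_fun D h) : \int[P]_(x in D) (expR (- rho * h x))%:E =
    \int[lebesgue_measure]_(t in `[0%R, +oo[) ccdf (RVZ h mh) t.
  rewrite -ge0_expectation_ccdf; last exact: Z0.
  rewrite unlock integral_mkcond; apply: eq_integral => x _.
  by rewrite /= /Z !patchE; case: ifP.
rewrite (EZ f mf) (EZ g mg).
set tau := expR (- rho * a); have tau0 : (0 < tau)%R by exact: expR_gt0.
have ccdfE (h : T -> R) (mh : measurable_fun D h) (t : R) : (0 < t)%R ->
    ccdf (RVZ h mh) t = P (D `&` [set x | (h x < - ln t / rho)%R]).
  move=> t0; rewrite /ccdf /distribution /pushforward /=; congr (P _).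
  apply/seteqP; split=> x /=; rewrite /Z patchE in_itv/= andbT.
    case: ifPn => [/set_mem Dx h1|_ h1]; last by have := lt_trans t0 h1; rewrite ltxx.
    split=> //; rewrite ltr_pdivlMr//.
    by move: h1; rewrite -[ltLHS]lnK ?posrE// ltr_expR; lra.
  move=> [Dx h1]; rewrite mem_set// -[ltLHS]lnK ?posrE// ltr_expR.
  by move: h1; rewrite ltr_pdivlMr// mulNr mulrC; lra.
(* Up to [tau] the indicator alone dominates a probability. From 1 on the left side vanishes because
   [f >= 0]. In between the sublevel is positive and below [a]. *)
have key (t : R) : (0 <= t)%R -> ccdf (RVZ f mf) t <= C%:E * ccdf (RVZ g mg) t + (\1_(`[0%R, tau]) t)%:E.
  move=> t0; have [ttau|taut] := leP t tau.
    rewrite indicE mem_set; last by rewrite /= in_itv/= t0.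
    apply: le_trans (probability_le1 _ _) _ => //.
    by rewrite leeDr// mule_ge0// lee_fin.
  have t1 : (0 < t)%R by exact: lt_trans taut.
  rewrite indicE memNset ?adde0; last first.
    by rewrite /= in_itv/= => /andP[_]; rewrite leNgt taut.
  rewrite !ccdfE//; have [t1'|t1'] := leP 1%R t.
    rewrite (_ : D `&` _ = set0) ?measure0 ?mule_ge0 ?lee_fin//.
    apply/seteqP; split=> // x [Dx /=]; have := f0 x Dx.
    have : (- ln t / rho <= 0)%R by rewrite mulr_le0_ge0 ?invr_ge0 ?(ltW rho0)// oppr_le0 ln_ge0.
    lra.
  have lt0 : (0 < - ln t / rho)%R by rewrite divr_gt0// oppr_gt0 ln_lt0// t1.
  have lta : (- ln t / rho < a)%R.
    rewrite ltr_pdivrMr//.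
    by move: taut; rewrite -[ltRHS]lnK ?posrE// ltr_expR; lra.
  apply: measure_sublevel_lt => // s /andP[s0 sa]; apply: le_fg.
  by rewrite s0 (lt_trans sa).
have mc (h : T -> R) (mh : measurable_fun D h) : measurable_fun setT (ccdf (RVZ h mh)).
  exact: ccdf_measurable.
apply: (@le_trans _ _ (\int[lebesgue_measure]_(t in `[0%R, +oo[)
    (C%:E * ccdf (RVZ g mg) t + (\1_(`[0%R, tau]) t)%:E))).
  apply: ge0_le_integral => //.
  - by apply: measurable_funTS; exact: mc.
  - apply: emeasurable_funD; last by apply/measurable_EFinP; exact: measurable_indic.
    by apply: measurable_funeM; apply: measurable_funTS; exact: mc.
  - by move=> t /=; rewrite in_itv/= andbT; exact: key.
rewrite ge0_integralD//; last 3 first.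
- by move=> t _; rewrite mule_ge0// lee_fin.
- by apply: measurable_funeM; apply: measurable_funTS; exact: mc.
- by apply/measurable_EFinP; exact: measurable_indic.
rewrite ge0_integralZl//; last first.
  by apply: measurable_funTS; exact: mc.
rewrite leeD2l// integral_indic//.
rewrite (_ : _ `&` _ = `[0%R, tau]%classic); last first.
  by rewrite setIidl// => t /=; rewrite !in_itv/= => /andP[->].
by have := lebesgue_measure_itv `[0%R, tau]; rewrite /= lte_fin tau0 -EFinB oppr0 addr0 => ->.
Qed.

End LayerCake.

Section DensityMeasure.
Context (R : realType) d (T : measurableType d) (mu : {measure set T -> \bar R}).
Local Open Scope ereal_scope.

Lemma density_measure (F : T -> R) : measurable_fun setT F -> (forall x, (0 <= F x)%R) ->
  {m : {measure set T -> \bar R} | (m : set T -> \bar R) = (fun A => \int[mu]_(x in A) (F x)%:E)}.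
Proof.
move=> mF F0; pose m A := \int[mu]_(x in A) (F x)%:E.
have m0 : m set0 = 0 by rewrite /m integral_set0.
have mge0 A : 0 <= m A by apply: integral_ge0 => x _; rewrite lee_fin.
have msa : semi_sigma_additive m.
  apply: semi_sigma_additive_nng_induced; first exact/measurable_EFinP.
  by move=> x; rewrite lee_fin.
pose M := isMeasure.Build _ _ _ m m0 mge0 msa.
pose mm : {measure set T -> \bar R} := HB.pack m M.
by exists mm.
Qed.

End DensityMeasure.

Lemma dual_ex (R : realType) (X : tvsType R) (f : X -> R) :
  (forall (a : R) x z, f (a *: x + z) = a * f x + f z) ->
  continuous f -> exists phi : dual X, forall x, phi x = f x.
Proof.
move=> lf cf.
pose L := GRing.isLinear.Build R X R^o *:%R (f : X -> R^o) lf.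
pose g : {linear X -> R^o} := HB.pack (f : X -> R^o) L.
by exists (@Dual R X g cf).
Qed.

(** * Measurability of standard representations and change of centre *)

Section StandardForm.
Context (R : realType) (X : tvsType R) (X_hausdorff : hausdorff_space X).
Context (mu : probability (borel X) R) (w y : X).
Context (Y : set X) (B : X -> X -> R).
Context (Y_std : lusin_standard (translate mu w) Y) (pB : psd_form Y B)
  (cB : forall K : set X, weakly_compact K -> @convex_set R X K -> K `<=` Y ->
     {within K `*` K, continuous (fun p : X * X => B p.1 p.2)})
  (Yh : Y (y - w)).
Let h := y - w.
Let lY : linear_subset Y := lusin_linear_subset Y_std.1.

Definition domain : set (borel X) := [set x | Y (x - w)].

Lemma translateN_measurable (z : X) (C : set (borel X)) : measurable C ->
  measurable ([set x | C (x - z)] : set (borel X)).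
Proof.
by move=> mC; rewrite -[X in measurable X]setTI; exact: (continuous_borel (@sub_cst_continuous _ _ z)).
Qed.

Lemma standard_measurable : measurable (Y : set (borel X)).
Proof.
have [_ [D Dn ->]] := Y_std; apply: bigcupT_measurable => n.
by apply: compact_borel => //; case: (Dn n).
Qed.

Lemma domain_measurable : measurable domain.
Proof. by apply: (translateN_measurable w); exact: standard_measurable. Qed.

Lemma domain_full : mu (~` domain) = 0%E.
Proof.
have mD := domain_measurable.
rewrite probability_setC//; suff -> : mu domain = 1%E by rewrite subee.
apply/eqP; rewrite eq_le probability_le1 ?andbT//=.
apply/lee_addgt0Pr => e e0; have [[[_ /(_ _ e0)[K [_ cK KY muK]]] _] _] := Y_std.
rewrite -leeBlDr// -EFinB (le_trans muK)//.
apply: (@le_measure _ _ _ mu [set x | K (x - w)] domain); rewrite ?inE//.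
  exact: (translateN_measurable w (compact_borel X_hausdorff cK)).
by move=> x /KY.
Qed.

(** As [y - w] lies in the linear subspace [Y], centring at [w] or at [y] gives one common domain of
    integration. *)
Lemma domainE x : domain x <-> Y (x - y).
Proof.
have E : x - w = (x - y) + h by rewrite /h addrA subrK.
rewrite /domain /= E; split=> [Yx|Yx]; last exact: linear_subsetD.
by rewrite -[x - y](addrK h); exact: linear_subsetB.
Qed.

(** [Y] is a countable union of compact disks, on each of which [B] is continuous. *)
Lemma diag_measurable : measurable_fun (Y : set (borel X)) (fun u => B u u : R).
Proof.
have [_ [D Dn YE]] := Y_std; have DY n : D n `<=` Y by rewrite YE; exact: bigcup_sup.
rewrite YE; apply/measurable_fun_bigcup => [n|n].
  by apply: compact_borel => //; case: (Dn n).
have [cD [vD _]] := Dn n; apply: within_continuous_borel; first exact: compact_closed.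
apply: (@within_comp _ _ _ _ (D n `*` D n) (fun u => (u, u)) (fun p => B p.1 p.2)).
- by move=> z; apply: cvg_pair => /=; exact: cvg_id.
- by move=> z Dz; split.
- by apply: cB => //; exact: compact_weakly_compact.
Qed.

Lemma slice_measurable z : Y z -> measurable_fun (Y : set (borel X)) (fun u => B u z : R).
Proof.
move=> Yz; have [_ [D Dn YE]] := Y_std; have DY n : D n `<=` Y by rewrite YE; exact: bigcup_sup.
rewrite [X in measurable_fun X]YE; apply/measurable_fun_bigcup => [n|n].
  by apply: compact_borel => //; case: (Dn n).
have [cD [vD _]] := Dn n; apply: within_continuous_borel; first exact: compact_closed.
apply: (@within_comp _ _ _ _ (D n `*` [set z]) (fun u => (u, z)) (fun p => B p.1 p.2)).
- by move=> z'; apply: cvg_pair => /=; [exact: cvg_id|exact: cvg_cst].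
- by move=> z' Dz; split.
- apply: (form_continuous_setX lY pB cB) => //; [exact: compact_set1|exact: convex_set1|].
  by move=> _ ->.
Qed.

Lemma comp_translate_measurable (z : X) (C : set (borel X)) (f : borel X -> R) :
  measurable C -> measurable_fun C f ->
  measurable_fun ([set x | C (x - z)] : set (borel X)) (fun x => f (x - z)).
Proof.
move=> mC mf; apply: (@measurable_comp _ _ _ _ _ _ C f).
- by [].
- by move=> _ [x Cx <-].
- by [].
by apply: measurable_funTS; exact: (continuous_borel (@sub_cst_continuous _ _ z)).
Qed.

Lemma domain_y : domain = [set x | Y (x - y)].
Proof. by apply/seteqP; split=> x /domainE. Qed.

Lemma measurable_p : measurable_fun domain (fun x => B (x - w) (x - w)).
Proof.
apply: (@comp_translate_measurable w Y (fun u => B u u) standard_measurable).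
exact: diag_measurable.
Qed.

Lemma measurable_q : measurable_fun domain (fun x => B (x - y) (x - y)).
Proof.
rewrite domain_y.
apply: (@comp_translate_measurable y Y (fun u => B u u) standard_measurable).
exact: diag_measurable.
Qed.

Lemma measurable_l : measurable_fun domain (fun x => B (x - y) h).
Proof.
rewrite domain_y.
apply: (@comp_translate_measurable y Y (fun u => B u h) standard_measurable).
exact: slice_measurable.
Qed.

Lemma measurable_dual (phi : dual X) : measurable_fun setT (fun x : borel X => phi x).
Proof. by apply: continuous_borelR; exact: dual_continuous. Qed.

(** [f] is measurable on [Y] only, so the integral is restricted to this full set before the change
    of variables. *)
Lemma integral_translate (f : X -> R) : (forall x, 0 <= f x) ->
  measurable_fun (Y : set (borel X)) (f : borel X -> R) ->
  (\int[translate mu y]_x (f x)%:E = \int[mu]_(x in domain) (f (x - y))%:E)%E.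
Proof.
move=> f0 mf; have [muy E] := translate_probability mu y.
have mY := standard_measurable.
have Y0 : muy (~` (Y : set (borel X))) = 0%E.
  have := congr1 (fun m => m (~` Y)) E; rewrite /translate /pushforward => <-.
  by rewrite -[X in mu X]/(~` [set x | Y (x - y)]) -domain_y domain_full.
transitivity (\int[translate mu y]_(x in Y) (f x)%:E)%E.
  rewrite E (ge0_integral_full setT mY Y0) ?setTI//.
rewrite /translate ge0_integral_pushforward//.
- by rewrite domain_y.
- exact: (continuous_borel (@sub_cst_continuous _ _ y)).
- exact/measurable_EFinP.
- by move=> x _; rewrite lee_fin.
Qed.

End StandardForm.

(** * The effective average action at a fixed scale *)

Section PositiveIntegral.
Context (R : realType) d (T : measurableType d) (P : probability T R).
Local Open Scope ereal_scope.

Lemma integral_expR_gt0 (D : set T) (f : T -> R) : measurable D -> P (~` D) = 0 ->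
  measurable_fun D f -> 0 < \int[P]_(x in D) (expR (f x))%:E.
Proof.
move=> mD D0 mf; rewrite lt0e integral_ge0 ?andbT; last first.
  by move=> x _; rewrite lee_fin expR_ge0.
apply/negP => /eqP I0.
have : ae_eq P D (fun x => (expR (f x))%:E) (cst 0).
  apply/(ae_eq_integral_abs _ mD).
    by apply/measurable_EFinP; apply: measurableT_comp.
  by under eq_integral do rewrite gee0_abs ?lee_fin ?expR_ge0//.
move=> [N [mN N0 NP]].
have DN : D `<=` N.
  move=> x Dx; apply: NP => /(_ Dx) /= [] /eqP; apply/negP.
  by rewrite gt_eqF// expR_gt0.
have : P D <= P N by rewrite le_measure ?inE.
rewrite N0; apply/negP; rewrite -ltNge.
move: D0; rewrite probability_setC// => /eqP; rewrite sube_eq ?fin_num_measure//.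
by rewrite add0e => /eqP <-.
Qed.

End PositiveIntegral.

(** Positivity of the form at [u / 2 - t h]. The weight 1/4 lets two such bounds be absorbed by the
    factor 1/2 of the quadratic exponent. *)
Lemma psd_mixed_le (R : realType) (X : tvsType R) (Y : set X) (C : X -> X -> R) (t : R) u h :
  linear_subset Y -> psd_form Y C -> Y u -> Y h -> `|t| <= 1 ->
  t * C u h <= C u u / 4 + C h h.
Proof.
move=> lY pC Yu Yh t1.
have Yth : Y (- t *: h) by exact: linear_subsetZ.
have := psd_ge0 pC (linear_subsetD lY (linear_subsetZ 2^-1 lY Yu) Yth).
have Yu2 : Y (2^-1 *: u) by exact: linear_subsetZ.
rewrite (psdDD lY pC)// !(psdZr lY pC)// !(psdZl lY pC)//.
have : t * t * C h h <= C h h.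
  by rewrite ler_piMl ?(psd_ge0 pC)// -expr2 -real_normK ?num_real// expr_le1.
by nra.
Qed.

Section FixedScale.
Context (R : realType) (X : tvsType R) (X_hausdorff : hausdorff_space X).
Context (mu : probability (borel X) R) (w y : X)
  (mu_exp : forall phi : dual X, mu.-integrable setT (fun x => (expR (phi x))%:E)).
Context (Y : set X) (B : X -> X -> R).
Context (Y_std : lusin_standard (translate mu w) Y) (pB : psd_form Y B)
  (cB : forall K : set X, weakly_compact K -> @convex_set R X K -> K `<=` Y ->
     {within K `*` K, continuous (fun p : X * X => B p.1 p.2)})
  (Yh : Y (y - w)).
Let h := y - w.
Let lY : linear_subset Y := lusin_linear_subset Y_std.1.
Let lT := @linear_subsetT R X.
Local Notation D := (domain w Y).

Context (Bn : nat -> X -> X -> R)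
  (pBn : forall n, psd_form setT (Bn n))
  (cBn : forall n, continuous (fun p : X * X => Bn n p.1 p.2))
  (ndBn : forall m n x, (m <= n)%N -> Bn m x x <= Bn n x x)
  (hh : Bn n h h @[n --> \oo] --> B h h)
  (aeB : {ae translate mu w, forall u : X, [/\ Y u, Bn n u u @[n --> \oo] --> B u u &
      Bn n u h @[n --> \oo] --> B u h]}).

Lemma nd_le (x : X) l : Bn n x x @[n --> \oo] --> l -> forall n, Bn n x x <= l.
Proof.
move=> cl n; rewrite -(cvg_lim (@Rhausdorff R) cl).
apply: (@nondecreasing_cvgn_le R (fun n => Bn n x x)); last by apply/cvg_ex; exists l.
by move=> i j; exact: ndBn.
Qed.

(** With [x - y = (x - w) - h], expanding the forms carries the convergences from [x - w] to
    [x - y]; monotonicity in [n] then gives the bound. *)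
Lemma ae_approx : {ae mu, forall x : X, [/\ Y (x - w),
  forall n, Bn n (x - y) (x - y) <= B (x - y) (x - y) &
  Bn n (x - y) h @[n --> \oo] --> B (x - y) h]}.
Proof.
have [N [mN N0 NP]] := aeB; exists [set x | N (x - w)]; split.
- exact: translateN_measurable.
- exact: N0.
move=> x /= nx; apply: NP => -[Yu uu uh]; apply: nx.
have xyE : x - y = (x - w) - h by rewrite /h opprB addrA subrK.
have uh' : Bn n (x - y) h @[n --> \oo] --> B (x - y) h.
  rewrite xyE (psdBl pB)//; under eq_fun do rewrite (psdBl (pBn _))//.
  exact: cvgB.
split=> //; apply: nd_le; rewrite xyE (psdBB lY pB)//.
under eq_fun do rewrite (psdBB lT (pBn _))//.
by apply: cvgD => //; apply: cvgB => //; exact: cvgMr.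
Qed.

(** At [a = 0] this is the numerator in the admissibility condition; at [a = -1] it is, up to a
    factor, the Laplace transform of the tilted measure. *)
Definition laplace (a : R) (phi : dual X) : \bar R :=
  (\int[mu]_(x in D) (expR (phi (x - y)%R + a * B (x - y)%R h - B (x - y)%R (x - y)%R / 2))%:E)%E.

Lemma measurable_laplace a (phi : dual X) : measurable_fun D
  (fun x => phi (x - y) + a * B (x - y) h - B (x - y) (x - y) / 2).
Proof.
apply: measurable_funB; last first.
  by apply: measurable_funM => //; exact: (measurable_q X_hausdorff Y_std cB Yh).
apply: measurable_funD; last first.
  by apply: measurable_funM => //; exact: (measurable_l X_hausdorff Y_std pB cB Yh).
apply: (@measurable_funTS _ _ (borel X) _ D (fun x => phi (x - y))).
apply: continuous_borelR => x.
apply: (@continuous_comp _ _ _ (fun z => z - y) phi); first exact: sub_cst_continuous.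
exact: dual_continuous.
Qed.

Lemma slice_dual n (c : R) : exists psi : dual X, forall x, psi x = c * Bn n x h.
Proof.
apply: dual_ex => [a x z|x].
  by have [-> // _ _] := pBn n; ring.
apply: cvgMr; apply: (@continuous_comp _ _ _ (fun z => (z, h)) (fun p : X * X => Bn n p.1 p.2)).
  by apply: cvg_pair => /=; [exact: cvg_id|exact: cvg_cst].
exact: cBn.
Qed.

Lemma dualD (phi psi : dual X) : exists chi : dual X, forall x, chi x = phi x + psi x.
Proof.
apply: dual_ex => [a x z|x]; last first.
  by apply: cvgD; exact: dual_continuous.
by rewrite !linearP /=; rewrite /GRing.scale/=; ring.
Qed.

Lemma dominant_integrable (phi : dual X) (c : R) :
  mu.-integrable D (fun x => (expR (phi (x - y) + c))%:E).
Proof.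
have mD := domain_measurable X_hausdorff Y_std.
apply: (@integrableS _ _ _ mu setT) => //.
rewrite (_ : (fun x => _) = (fun x => ((expR (c - phi y))%:E * (expR (phi x))%:E)%E)).
  exact: integrableZl.
by apply/funext => x; rewrite -EFinM -expRD linearB /= [_ + phi x]addrC addrA addrAC.
Qed.

(** [B (.) h] need not be continuous, but the functionals [Bn n (.) h] are; dominated convergence
    trades one for the other and so changes the coefficient [a] by [c]. *)
Lemma laplace_cvg (a c : R) (phi : dual X) : `|a| <= 1 -> `|c| <= 1 ->
  (exists psi : nat -> dual X, (forall n x, psi n x = phi x + c * Bn n x h)) /\
  forall psi : nat -> dual X, (forall n x, psi n x = phi x + c * Bn n x h) ->
  (laplace a (psi n) @[n --> \oo] --> laplace (a + c) phi) /\ (laplace (a + c) phi < +oo)%E.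
Proof.
move=> a1 c1; split.
  suff /choice[psi psiE] : forall n, exists psi : dual X, forall x, psi x = phi x + c * Bn n x h.
    by exists psi.
  move=> n; have [f fE] := slice_dual n c; have [g gE] := dualD phi f.
  by exists g => x; rewrite gE fE.
move=> psi psiE.
have mD := domain_measurable X_hausdorff Y_std.
have [N [mN N0 NP]] := ae_approx.
have [|||||ig _ cg] := @dominated_convergence _ _ _ mu D mD
  (fun n x => (expR (psi n (x - y) + a * B (x - y) h - B (x - y) (x - y) / 2))%:E)
  (fun x => (expR (phi (x - y) + (a + c) * B (x - y) h - B (x - y) (x - y) / 2))%:E)
  (* Two uses of [psd_mixed_le], for [B] and for [Bn n <= B], cost at most [B (x - y) (x - y) / 2],
     which the exponent cancels, and [2 * B h h]. *)
  (fun x => (expR (phi (x - y) + 2 * B h h))%:E).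
- by move=> n; apply/measurable_EFinP; apply: measurableT_comp => //; exact: measurable_laplace.
- by apply/measurable_EFinP; apply: measurableT_comp => //; exact: measurable_laplace.
- exists N; split=> // x nx; apply: NP => -[Yx _ uh]; apply: nx => _.
  apply/cvg_EFin; first exact: nearW.
  apply: continuous_cvg; first exact: continuous_expR.
  rewrite mulrDl; apply: cvgB; last exact: cvg_cst.
  under eq_fun do rewrite psiE -addrA [_ * Bn _ _ _ + _]addrC.
  apply: cvgD; first exact: cvg_cst.
  by apply: cvgD; [exact: cvg_cst|exact: cvgMr].
- exact: dominant_integrable.
- exists N; split=> // x nx; apply: NP => -[Yx nle _]; apply: nx => n Dx.
  have Yu : Y (x - y) by apply/(domainE Y_std Yh).
  rewrite gee0_abs ?lee_fin ?expR_ge0// ler_expR psiE.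
  have := psd_mixed_le lY pB Yu Yh a1.
  have := psd_mixed_le lT (pBn n) (u := x - y) (h := h) Logic.I Logic.I c1.
  have := nle n; have := nd_le hh n; rewrite /h; lra.
split=> //; rewrite ltey_eq; apply/orP; left; exact: integrable_fin_num.
Qed.

Lemma laplace_fin a phi : a = 0 \/ a = -1 -> exists2 c : R, 0 < c & laplace a phi = c%:E.
Proof.
move=> a01.
have fin : (laplace a phi < +oo)%E.
  have n1 : `|-1 : R| <= 1 by rewrite normrN1.
  have n0 : `|0 : R| <= 1 by rewrite normr0.
  case: a01 => ->.
    have [[psi psiE] H] := laplace_cvg phi n0 n0.
    by have [_] := H psi psiE; rewrite addr0.
  have [[psi psiE] H] := laplace_cvg phi n0 n1.
  by have [_] := H psi psiE; rewrite add0r.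
have pos : (0 < laplace a phi)%E.
  apply: integral_expR_gt0; last exact: measurable_laplace.
  - exact: (domain_measurable X_hausdorff Y_std).
  - exact: (domain_full X_hausdorff Y_std).
move: pos fin; case: (laplace a phi) => // c; rewrite lte_fin => c0 _.
by exists c.
Qed.

Definition partition_function : \bar R := (\int[mu]_(x in D) (expR (- B (x - w)%R (x - w)%R / 2))%:E)%E.

Lemma measurable_partition : measurable_fun D (fun x => expR (- B (x - w) (x - w) / 2)).
Proof.
apply: measurableT_comp => //; apply: measurable_funM => //; apply: measurableT_comp => //.
exact: (measurable_p X_hausdorff Y_std cB).
Qed.

Lemma partitionE : (\int[mu]_x (expR (- Qf w B x / 2))%:E)%E = partition_function.
Proof.
rewrite (@ge0_integral_full _ _ _ mu D)//; first by rewrite setTI.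
- exact: (domain_measurable X_hausdorff Y_std).
- exact: (domain_full X_hausdorff Y_std).
Qed.

Lemma partition_fin : exists2 N : R, 0 < N & partition_function = N%:E.
Proof.
have mD := domain_measurable X_hausdorff Y_std.
have pos : (0 < partition_function)%E.
  apply: integral_expR_gt0 => //; first exact: (domain_full X_hausdorff Y_std).
  apply: measurable_funM => //; apply: measurableT_comp => //.
  exact: (measurable_p X_hausdorff Y_std cB).
have fin : (partition_function <= 1)%E.
  apply: (@le_trans _ _ (\int[mu]_(x in D) (cst 1 x))%E).
    apply: ge0_le_integral => //.
    - by apply/measurable_EFinP; exact: measurable_partition.
    - move=> x Dx; rewrite lee_fin -expR0 ler_expR mulNr oppr_le0.
      by rewrite divr_ge0// (psd_ge0 pB).
  by rewrite integral_cst// mul1e probability_le1.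
move: pos fin; case: partition_function => // c; rewrite lte_fin => c0 _.
by exists c.
Qed.

(** Expands the quadratic exponent at [x - w = (x - y) + h]; the mixed term gives the coefficient
    -1, and the constants leave the integral. *)
Lemma tilted_laplace (phi : dual X) (N : R) : 0 < N -> partition_function = N%:E ->
  (\int[tilted mu (Qf w B)]_x (expR (phi x))%:E =
   (expR (phi y - B h h / 2) / N)%:E * laplace (-1) phi)%E.
Proof.
move=> N0 NE.
have mD := domain_measurable X_hausdorff Y_std.
have D0 := domain_full X_hausdorff Y_std.
pose F := ((fun x => expR (- B (x - w) (x - w) / 2)) \_ D : borel X -> R).
have mF : measurable_fun setT F.
  by apply/(measurable_restrictT _ mD); exact: measurable_partition.
have F0 x : 0 <= F x by rewrite /F patchE; case: ifP => // _; exact: expR_ge0.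
have [m mE] := density_measure mu mF F0.
have Ninv : 0 <= N^-1 by rewrite invr_ge0 ltW.
have tE : tilted mu (Qf w B) = mscale (NngNum Ninv) m.
  apply/funext => A; rewrite /tilted partitionE NE inver gt_eqF// /mscale mE.
  congr (_ * _)%E; rewrite [LHS](@ge0_integral_full _ _ _ mu D)//.
  rewrite integral_mkcondr; apply: eq_integral => x _.
  by rewrite /F !patchE; case: ifP.
have mphi : measurable_fun setT (fun x : borel X => (expR (phi x))%:E).
  apply/measurable_EFinP; apply: measurableT_comp => //; exact: measurable_dual.
rewrite tE ge0_integral_mscale//.
have mE' A : measurable A -> m A = (\int[mu]_(x in A) (F x)%:E)%E by rewrite mE.
rewrite (integral_density mF F0 mE')//.
rewrite (@ge0_integral_full _ _ _ mu D)//; last first.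
  by move=> x; apply: mule_ge0; rewrite lee_fin ?expR_ge0.
rewrite setTI -ge0_integralZl_EFin//; last 2 first.
- by move=> x _; rewrite mule_ge0 ?lee_fin// expR_ge0.
- apply: measurable_funTS; apply: emeasurable_funM => //; exact/measurable_EFinP.
rewrite -[RHS]ge0_integralZl_EFin//; last 2 first.
- by apply/measurable_EFinP; apply: measurableT_comp => //; exact: measurable_laplace.
- by rewrite divr_ge0 ?expR_ge0// ltW.
apply: eq_integral => x /set_mem Dx; rewrite /F patchE mem_set//.
have Yu : Y (x - y) by apply/(domainE Y_std Yh).
have xwE : x - w = (x - y) + h by rewrite /h addrA subrK.
rewrite xwE (psdDD lY pB)// -!EFinM; congr (_%:E).
rewrite /= [RHS]mulrAC [in RHS]mulrC -!expRD; congr (_ * expR _).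
by rewrite linearB /=; field.
Qed.

(** Each term of the conjugate equals [ln N + B h h / 2] minus the logarithm of [laplace (-1) phi],
    and [B h h / 2] cancels in the action. For the lower bound, the functionals [Bn n (.) h] bring
    [laplace (-1)] close to [D0]. For the upper bound, [laplace (-1) phi] is a limit of values of
    [laplace 0], all at least [eta * D0]. *)
Lemma average_action_bounds (N D0 eta : R) : 0 < N -> partition_function = N%:E ->
  0 < D0 -> (\int[mu]_(x in D) (expR (- B (x - y)%R (x - y)%R / 2))%:E = D0%:E)%E ->
  0 < eta -> (forall phi, ((eta * D0)%:E <= laplace 0 phi)%E) ->
  ((ln (N / D0))%:E <= average_action mu w B y <= (ln (N / D0) - ln eta)%:E)%E.
Proof.
move=> N0 NE D0gt0 D0E eta0 etaD.
have n1 : `|-1 : R| <= 1 by rewrite normrN1.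
have n1' : `|1 : R| <= 1 by rewrite normr1.
have n0 : `|0 : R| <= 1 by rewrite normr0.
have term (phi : dual X) (c : R) : 0 < c -> laplace (-1) phi = c%:E ->
    ((phi y)%:E - lne (\int[tilted mu (Qf w B)]_x (expR (phi x))%:E))%E =
    (ln N + B h h / 2 - ln c)%:E.
  move=> c0 cE; rewrite (tilted_laplace phi N0 NE) cE -EFinM.
  have e0 : 0 < expR (phi y - B h h / 2) / N by rewrite divr_gt0 ?expR_gt0.
  rewrite lne_EFin; last exact: mulr_gt0.
  set t := (X in (_ - (ln X)%:E)%E); suff -> : ln N + B h h / 2 - ln c = phi y - ln t by [].
  have tE : t = expR (phi y - B h h / 2) / N * c by [].
  have ex0 := @expR_gt0 R (phi y - B h h / 2).
  by rewrite tE (@lnM _ (_ / N) c) ?posrE// ln_div ?posrE// expRK; ring.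
rewrite /average_action -/h ln_div ?posrE//; apply/andP; split.
  rewrite leeBrDr//; apply/lee_addgt0Pr => e e0.
  have [zero zeroE] : exists zero : dual X, forall x, zero x = 0.
    by apply: dual_ex => [a x z|x]; [rewrite mulr0 addr0|exact: cvg_cst].
  have [[psi psiE] H] := laplace_cvg zero n1 n1'.
  have [cpsi _] := H psi psiE; rewrite addNr in cpsi.
  have E0 : laplace 0 zero = D0%:E.
    rewrite -D0E; apply: eq_integral => x _.
    by rewrite zeroE mul0r !add0r mulNr.
  rewrite E0 in cpsi.
  have lt1 : (D0%:E < (D0 * expR e)%:E)%E by rewrite lte_fin ltr_pMr// expR_gt1.
  have [n _ /(_ n (leqnn _)) /= ltn] := cpsi _ (open_nbhs_nbhs (conj (@open_ereal_lt_ereal R _) lt1)).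
  have [c c0 cE] := laplace_fin (psi n) (or_intror erefl).
  rewrite cE lte_fin -ltr_ln ?posrE ?mulr_gt0 ?expR_gt0// lnM ?posrE ?expR_gt0// expRK in ltn.
  apply: (@le_trans _ _ ((ln N + B h h / 2 - ln c)%:E + e%:E)%E).
    by rewrite -!EFinD lee_fin; lra.
  rewrite leeD2r// -(term _ _ c0 cE); apply: ereal_sup_ubound.
  by exists (psi n).
rewrite leeBlDr// -EFinD; apply: ge_ereal_sup => _ [phi _ <-].
have [c c0 cE] := laplace_fin phi (or_intror erefl).
rewrite (term _ _ c0 cE) lee_fin.
have [[psi psiE] H] := laplace_cvg phi n0 n1.
have [cpsi _] := H psi psiE; rewrite add0r cE in cpsi.
have : ((eta * D0)%:E <= c%:E)%E.
  rewrite -(cvg_lim (@ereal_hausdorff R) cpsi); apply: lime_ge.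
    by apply/cvg_ex; eexists; exact: cpsi.
  exact: nearW.
rewrite lee_fin -ler_ln ?posrE ?mulr_gt0// lnM ?posrE//; lra.
Qed.

End FixedScale.

(** * Comparison with the measures of balls *)

(** A Lusin linear subspace for the translated measure, shifted back by [w], is a Lusin affine
    subspace for [mu]. *)
Lemma calA_calH (R : realType) (X : tvsType R) (mu : set (borel X) -> \bar R) (w y : X) :
  calA mu y -> calH (translate mu w) (y - w).
Proof.
move=> Ay Z [[aZ lZ] Z0]; apply: (Ay [set x | Z (x - w)]); split=> [t x z Zx Zz /=|e e0].
  have -> : t *: x + (1 - t) *: z - w = t *: (x - w) + (1 - t) *: (z - w).
    rewrite !scalerBr addrACA -opprD; congr (_ - _).
    by rewrite -scalerDl addrC subrK scale1r.
  exact: aZ.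
have [K [vK cK KZ muK]] := lZ e e0.
have [cT vT] := compact_convexD cK (@compact_set1 X w) vK (@convex_set1 R X w).
exists [set p.1 + p.2 | p in K `*` [set w]]; split=> //.
  by move=> _ [[a _] [/= /KZ Za ->] <-] /=; rewrite addrK.
rewrite (_ : [set _ | _ in _] = [set x | K (x - w)])//.
apply/seteqP; split=> [_ [[a _] [/= Ka ->] <-] /=|x Kx]; first by rewrite addrK.
by exists (x - w, w) => //=; rewrite subrK.
Qed.

(** One-sided bounds at real levels treat finite and infinite limits alike. *)
Lemma cvg_ereal_pinfty (R : realType) (f : R -> \bar R) (F : \bar R) :
  (forall t : R, (F < t%:E)%E -> \forall k \near +oo, (f k <= t%:E)%E) ->
  (forall t : R, (t%:E < F)%E -> \forall k \near +oo, (t%:E <= f k)%E) ->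
  f k @[k --> +oo] --> F.
Proof.
case: F => [c||] up lo.
- have bd e : 0 < e -> \forall k \near +oo, ((c - e)%:E <= f k <= (c + e)%:E)%E.
    move=> e0; near=> k; apply/andP; split; near: k.
      by apply: lo; rewrite lte_fin gtrBl.
    by apply: up; rewrite lte_fin ltrDl.
  apply/fine_cvgP; split.
    apply: filterS (bd _ ltr01) => k /andP[h1 h2].
    by rewrite fin_numElt (lt_le_trans _ h1) ?ltNyr// (le_lt_trans h2) ?ltry.
  apply/cvgrPdist_le => e e0; apply: filterS (bd _ e0) => k /andP[] /=.
  case: (f k) => [z||]//=; rewrite !lee_fin => h1 h2.
  by rewrite ler_norml; apply/andP; split; lra.
- by apply/cvgeyPge => t; apply: lo; rewrite ltry.
- by apply/cvgeNyPle => t; apply: up; rewrite ltNyr.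
Unshelve. all: by end_near. Qed.

Section Ratio.
Context (R : realType).
Local Open Scope ereal_scope.

(** Clears the denominator. If [a = 0] the bound is trivial; if [b = 0 < a] the quotient is [+oo],
    against the strict inequality. *)
Lemma lne_ratio_lt (a b t : R) : (0 <= a)%R -> (0 <= b)%R ->
  ~ (a%:E = 0 /\ b%:E = 0) -> lne (a%:E / b%:E) < t%:E -> (a <= expR t * b)%R.
Proof.
move=> a0 b0 ab; have [->|aN] := eqVneq a 0%R; first by rewrite mulr_ge0// expR_ge0.
have a0' : (0 < a)%R by rewrite lt_neqAle eq_sym aN.
rewrite inver; case: eqP => [->|/eqP bN].
  by rewrite gt0_muley ?lte_fin//= ltNge leey.
have b0' : (0 < b)%R by rewrite lt_neqAle eq_sym bN.
rewrite -EFinM lne_EFin ?divr_gt0// lte_fin -ltr_expR lnK ?posrE ?divr_gt0//.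
by rewrite ltr_pdivrMr// => /ltW.
Qed.

Lemma lne_ratio_gt (a b t : R) : (0 <= a)%R -> (0 <= b)%R ->
  t%:E < lne (a%:E / b%:E) -> (b <= expR (- t) * a)%R.
Proof.
move=> a0 b0; have [->|bN] := eqVneq b 0%R; first by rewrite mulr_ge0// expR_ge0.
have b0' : (0 < b)%R by rewrite lt_neqAle eq_sym bN.
rewrite inver (negbTE bN) -EFinM; have [->|aN] := eqVneq a 0%R.
  by rewrite mul0r le0_lneNy.
have a0' : (0 < a)%R by rewrite lt_neqAle eq_sym aN.
rewrite lne_EFin ?divr_gt0// lte_fin -ltr_expR lnK ?posrE ?divr_gt0//.
by rewrite ltr_pdivlMr// expRN ler_pdivlMl ?expR_gt0// => /ltW.
Qed.

Lemma ereal_lt_dense_r (F : \bar R) (t : R) : F < t%:E ->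
  exists2 t0 : R, F < t0%:E & (t0 < t)%R.
Proof.
case: F => [c|//|_]; last by exists (t - 1)%R; [rewrite ltNyr|rewrite gtrBl].
by rewrite lte_fin => ct; exists ((c + t) / 2)%R; rewrite ?lte_fin; lra.
Qed.

Lemma ereal_lt_dense_l (F : \bar R) (t : R) : t%:E < F ->
  exists2 t0 : R, t0%:E < F & (t < t0)%R.
Proof.
case: F => [c|_|//]; last by exists (t + 1)%R; [rewrite ltry|rewrite ltrDl].
by rewrite lte_fin => ct; exists ((c + t) / 2)%R; rewrite ?lte_fin; lra.
Qed.

End Ratio.

(** * Estimates at one scale, linking the representations of I_k and J_k *)

Section ScaleFacts.
Context (R : realType) (X : tvsType R) (X_hausdorff : hausdorff_space X).
Context (w y : X) (mu : probability (borel X) R) (mu_radon : radon mu)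
  (mu_exp : forall phi : dual X, mu.-integrable setT (fun x => (expR (phi x))%:E))
  (nu2 : {measure set (borel (X * X)%type) -> \bar R})
  (nu2_radon_square : radon_square (translate mu w) nu2).
Context (f : X * X -> \bar R) (f_mem : calI (translate mu w) nu2 f)
  (Y : set X) (B : X -> X -> R) (f_rep : standard_rep (translate mu w) nu2 f Y B).
Context (r : R) (r_gt0 : 0 < r) (YJ : set X) (BJ : X -> X -> R)
  (J_rep : standard_rep (translate mu w) nu2 (Jf r f) YJ BJ)
  (y_mem : calA mu y).
Let h := y - w.

(** Thus [r ^+ 2 * BJ] represents the same kernel as [B]. Infinite values of [f] are excluded since
    scaling would preserve them. *)
Lemma rescaled_ae : {ae nu2, forall p : X * X, f p = (r ^+ 2 * BJ p.1 p.2)%:E}.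
Proof.
have r20 : 0 < r ^+ 2 by rewrite exprn_gt0.
have unscale (v : \bar R) (b : R) : (v * (r ^- 2)%:E)%E = b%:E -> v = (r ^+ 2 * b)%:E.
  case: v => [c||].
  - by move=> [<-]; rewrite mulrC divfK// gt_eqF.
  - by rewrite gt0_mulye// lte_fin invr_gt0.
  - by rewrite gt0_mulNye// lte_fin invr_gt0.
have [_ _ _ [N [mN N0 NP]]] := J_rep; exists N; split=> // p np; apply: NP => Jp; apply: np.
exact: unscale Jp.
Qed.

(** The sequence is chosen before the form, so any two forms representing [f] are limits of the same
    [Bn] and can be compared. *)
Lemma scale_approx : exists Bn : nat -> X -> X -> R,
  [/\ (forall n, psd_form setT (Bn n)),
      (forall n, continuous (fun p : X * X => Bn n p.1 p.2)),
      (forall m n x, (m <= n)%N -> Bn m x x <= Bn n x x) &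
   forall (Z : set X) (C : X -> X -> R), lusin_standard (translate mu w) Z -> psd_form Z C ->
     (forall K : set X, weakly_compact K -> @convex_set R X K -> K `<=` Z ->
        {within K `*` K, continuous (fun p : X * X => C p.1 p.2)}) ->
     {ae nu2, forall p : X * X, f p = (C p.1 p.2)%:E} ->
     [/\ Z h, Bn n h h @[n --> \oo] --> C h h &
       {ae translate mu w, forall u : X, [/\ Z u, Bn n u u @[n --> \oo] --> C u u &
         Bn n u h @[n --> \oo] --> C u h]}]].
Proof.
have [_ [Bn [pcBn ndBn sBn fBn]]] := f_mem; exists Bn.
split=> // [n|n|Z C Zs pC cC fC]; [by case: (pcBn n)|by case: (pcBn n)|].
have Hh := @calA_calH _ _ _ w _ y_mem; have [nu E] := translate_probability mu w.
have rnu := @radon_translate _ _ mu w mu_radon.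
have [_ prod2] := nu2_radon_square.
rewrite E in Hh rnu sBn prod2 Zs *.
apply: (form_limit X_hausdorff rnu (fun n => (pcBn n).1) (fun n => (pcBn n).2) ndBn sBn Zs.1 prod2 pC cC fBn fC Hh).
Qed.

Lemma ball_measureE a s : ball_measure mu w YJ BJ a s =
  mu (domain w YJ `&` [set x | BJ (x - a) (x - a) <= s ^+ 2]).
Proof. by []. Qed.

Lemma ball_measure_fin a s : a = w \/ a = y ->
  exists2 b : R, 0 <= b & ball_measure mu w YJ BJ a s = b%:E.
Proof.
move=> aE; have [YJs pBJ cBJ _] := J_rep.
have YJh : YJ h by exact: (@calA_calH _ _ _ w _ y_mem YJ YJs.1).
have mDJ := domain_measurable X_hausdorff YJs.
have ma : measurable_fun (domain w YJ) (fun x => BJ (x - a) (x - a)).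
  case: aE => ->; first exact: (measurable_p X_hausdorff YJs cBJ).
  exact: (measurable_q X_hausdorff YJs cBJ YJh).
have mS := ma mDJ `]-oo, s ^+ 2]%classic (measurable_itv _).
rewrite set_itvNyc in mS; rewrite ball_measureE.
rewrite -(fineK (fin_num_measure mu _ mS)); exists (fine (mu (domain w YJ `&`
  [set x | BJ (x - a) (x - a) <= s ^+ 2]))) => //; exact: fine_ge0.
Qed.

Let rho : R := r ^+ 2 / 2.

(* The forms of two representations of proportional kernels are proportional on a
   set of full measure, which is all that the integrals below see. *)
Lemma integral_rescale (a : X) : a = w \/ a = y ->
  (\int[mu]_(x in domain w Y) (expR (- B (x - a)%R (x - a)%R / 2))%:E =
   \int[mu]_(x in domain w YJ) (expR (- rho * BJ (x - a)%R (x - a)%R))%:E)%E.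
Proof.
move=> aE.
have [Ys pB cB fB] := f_rep; have [YJs pBJ cBJ _] := J_rep.
have [Bn [pBn cBn ndBn lim]] := scale_approx.
have [Yh hh aeB] := lim _ _ Ys pB cB fB.
have r20 : 0 <= r ^+ 2 by rewrite exprn_ge0// ltW.
have crBJ (K : set X) : weakly_compact K -> @convex_set R X K -> K `<=` YJ ->
    {within K `*` K, continuous (fun p : X * X => r ^+ 2 * BJ p.1 p.2)}.
  move=> wK vK KY; have /subspace_continuousP cK := cBJ K wK vK KY.
  by apply/subspace_continuousP => p Kp; apply: cvgMr; exact: cK.
have [YJh hhJ aeBJ] := lim _ _ YJs (psd_formZ r20 pBJ) crBJ rescaled_ae.
have [N1 [mN1 N10 NP1]] := aeB; have [N2 [mN2 N20 NP2]] := aeBJ.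
(* Off this null set both forms are limits of the same sequence, hence equal. *)
pose M : set (borel X) := [set x | N1 (x - w)] `|` [set x | N2 (x - w)].
have mM1 : measurable ([set x | N1 (x - w)] : set (borel X)) by exact: translateN_measurable.
have mM2 : measurable ([set x | N2 (x - w)] : set (borel X)) by exact: translateN_measurable.
have mM : measurable M by exact: measurableU.
have M0 : mu (~` (~` M)) = 0%E.
  by rewrite setCK /M measureU0.
have full (Z : set X) (g : X -> R) : lusin_standard (translate mu w) Z -> (forall x, 0 <= g x) ->
    (\int[mu]_(x in domain w Z) (g x)%:E = \int[mu]_(x in ~` M) (g x)%:E)%E.
  move=> Zs g0.
  rewrite -[in RHS](setTI (~` M)) -(@ge0_integral_full _ _ _ mu _ _ _ (measurableC mM) M0)//.
  rewrite (@ge0_integral_full _ _ _ mu (domain w Z) setT)// ?setTI//.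
  - exact: (domain_measurable X_hausdorff Zs).
  - exact: (domain_full X_hausdorff Zs).
rewrite full// [RHS]full//.
apply: eq_integral => x /set_mem /not_orP[nN1 nN2].
have [Yu uu uh] : [/\ Y (x - w), Bn n (x - w) (x - w) @[n --> \oo] --> B (x - w) (x - w) &
    Bn n (x - w) h @[n --> \oo] --> B (x - w) h].
  by apply: contrapT => ?; apply: nN1; exact: NP1.
have [YJu uuJ uhJ] : [/\ YJ (x - w),
    Bn n (x - w) (x - w) @[n --> \oo] --> r ^+ 2 * BJ (x - w) (x - w) &
    Bn n (x - w) h @[n --> \oo] --> r ^+ 2 * BJ (x - w) h].
  by apply: contrapT => ?; apply: nN2; exact: NP2.
have Euu := cvg_unique (@Rhausdorff R) uu uuJ.
have Euh := cvg_unique (@Rhausdorff R) uh uhJ.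
have Ehh := cvg_unique (@Rhausdorff R) hh hhJ.
have lY := lusin_linear_subset Ys.1; have lYJ := lusin_linear_subset YJs.1.
suff -> : B (x - a) (x - a) = r ^+ 2 * BJ (x - a) (x - a).
  by congr (expR _)%:E; rewrite /rho; field.
case: aE => ->; first exact: Euu.
have -> : x - y = (x - w) - h by rewrite /h opprB addrA subrK.
by rewrite (psdBB lY pB)// (psdBB lYJ pBJ)// Euu Euh Ehh; ring.
Qed.

(** [N] and [D0] are the Gaussian-type integrals centred at [w] and [y]. The clauses give the bounds
    on the action, the layer-cake comparison of the centres in both directions, and a Markov-type
    lower bound for [N]. *)
Lemma scale_facts : exists N D0 : R, [/\ 0 < N /\ 0 < D0,
  forall eta : R, 0 < eta ->
    (eta%:E <= ereal_inf (range (fun phi : dual X =>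
      (\int[translate mu y]_x (expR (phi x - B x x / 2))%:E /
       \int[translate mu y]_x (expR (- B x x / 2))%:E)%E)))%E ->
    ((ln (N / D0))%:E <= average_action mu w B y <= (ln (N / D0) - ln eta)%:E)%E,
  forall C del : R, 0 <= C -> 0 < del ->
    (forall s, 0 < s < del ->
      (ball_measure mu w YJ BJ w s <= C%:E * ball_measure mu w YJ BJ y s)%E) ->
    N <= C * D0 + expR (- rho * del ^+ 2),
  forall C del : R, 0 <= C -> 0 < del ->
    (forall s, 0 < s < del ->
      (ball_measure mu w YJ BJ y s <= C%:E * ball_measure mu w YJ BJ w s)%E) ->
    D0 <= C * N + expR (- rho * del ^+ 2) &
  forall c s : R, 0 < c -> 0 < s -> (c%:E <= ball_measure mu w YJ BJ w s)%E ->
    c * expR (- rho * s ^+ 2) <= N].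
Proof.
have [Ys pB cB fB] := f_rep; have [YJs pBJ cBJ _] := J_rep.
have [Bn [pBn cBn ndBn lim]] := scale_approx.
have [Yh hh aeB] := lim _ _ Ys pB cB fB.
have lY := lusin_linear_subset Ys.1; have lYJ := lusin_linear_subset YJs.1.
have YJh : YJ h by exact: (@calA_calH _ _ _ w _ y_mem YJ YJs.1).
have [N N0 NE] := partition_fin X_hausdorff Ys pB cB.
have [zero zeroE] : exists zero : dual X, forall x, zero x = 0.
  by apply: dual_ex => [a x z|x]; [rewrite mulr0 addr0|exact: cvg_cst].
have [D0 D00 D0E'] := laplace_fin X_hausdorff mu_exp Ys pB cB Yh pBn cBn ndBn hh aeB zero (or_introl erefl).
have D0E : (\int[mu]_(x in domain w Y) (expR (- B (x - y)%R (x - y)%R / 2))%:E = D0%:E)%E.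
  by rewrite -D0E'; apply: eq_integral => x _; rewrite zeroE mul0r !add0r mulNr.
have NJ := integral_rescale (or_introl erefl); have DJ := integral_rescale (or_intror erefl).
rewrite -/(partition_function mu w Y B) NE in NJ; rewrite D0E in DJ.
have rho0 : 0 < rho by rewrite divr_gt0// exprn_gt0.
have mDJ := domain_measurable X_hausdorff YJs.
have mpJ := measurable_p X_hausdorff YJs cBJ.
have mqJ := measurable_q X_hausdorff YJs cBJ YJh.
have YJy x : domain w YJ x -> YJ (x - y) by move=> /(domainE YJs YJh).
(* The layer-cake lemma uses levels of the quadratic form, which are squares of ball radii. *)
have radius (del t : R) : 0 < del -> 0 < t < del ^+ 2 -> 0 < Num.sqrt t < del /\ Num.sqrt t ^+ 2 = t.
  move=> del0 /andP[t0 td]; rewrite sqr_sqrtr ?ltW// sqrtr_gt0 t0/=; split=> //.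
  by rewrite -[ltRHS]gtr0_norm// -sqrtr_sqr ltr_sqrt// exprn_gt0.
exists N, D0; split=> //.
- move=> eta eta0 inf_ge.
  apply: (average_action_bounds X_hausdorff mu_exp Ys pB cB Yh pBn cBn ndBn hh aeB) => // phi.
  have : (eta%:E <= \int[translate mu y]_x (expR (phi x - B x x / 2))%:E /
      \int[translate mu y]_x (expR (- B x x / 2))%:E)%E.
    by apply: le_trans inf_ge _; apply: ereal_inf_lbound; exists phi.
  have mBY := diag_measurable X_hausdorff Ys cB.
  rewrite (@integral_translate _ _ X_hausdorff mu w y Y Ys Yh (fun x => expR (phi x - B x x / 2))); last 2 first.
  + by move=> x; exact: expR_ge0.
  + apply: measurableT_comp => //; apply: measurable_funB; last exact: measurable_funM.
    by apply: measurable_funTS; exact: measurable_dual.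
  rewrite (@integral_translate _ _ X_hausdorff mu w y Y Ys Yh (fun x => expR (- B x x / 2))); last 2 first.
  + by move=> x; exact: expR_ge0.
  + by apply: measurableT_comp => //; apply: measurable_funM => //; exact: measurableT_comp.
  rewrite D0E inver gt_eqF// => le_eta.
  have [c c0 cE] := laplace_fin X_hausdorff mu_exp Ys pB cB Yh pBn cBn ndBn hh aeB phi (or_introl erefl).
  rewrite cE lee_fin; move: le_eta.
  rewrite (_ : (\int[mu]_(x in _) _)%E = c%:E).
    by rewrite -EFinM lee_fin ler_pdivlMr.
  by rewrite -cE; apply: eq_integral => x _; rewrite mul0r addr0.
- move=> C del C0 del0 le_ball; rewrite -lee_fin EFinD EFinM NJ DJ.
  apply: integral_expR_le => //; first by move=> x Dx; exact: (psd_ge0 pBJ).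
    by rewrite exprn_gt0.
  move=> t /(radius _ _ del0)[s_itv sE]; have := le_ball _ s_itv.
  by rewrite !ball_measureE sE.
- move=> C del C0 del0 le_ball; rewrite -lee_fin EFinD EFinM NJ DJ.
  apply: integral_expR_le => //; first by move=> x /YJy Dx; exact: (psd_ge0 pBJ).
    by rewrite exprn_gt0.
  move=> t /(radius _ _ del0)[s_itv sE]; have := le_ball _ s_itv.
  by rewrite !ball_measureE sE.
- move=> c s c0 s0; rewrite ball_measureE => cball.
  set S := (X in mu X) in cball.
  have mS : measurable S.
    have := mpJ mDJ `]-oo, s ^+ 2]%classic (measurable_itv _).
    by rewrite set_itvNyc.
  rewrite -lee_fin NJ EFinM muleC.
  apply: (@le_trans _ _ ((expR (- rho * s ^+ 2))%:E * mu S)%E).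
    by rewrite lee_wpmul2l// lee_fin expR_ge0.
  rewrite -integral_cst//; apply: (@le_trans _ _
    (\int[mu]_(x in S) (expR (- rho * BJ (x - w) (x - w)))%:E)%E).
    apply: ge0_le_integral => //.
    - by move=> x _; rewrite lee_fin expR_ge0.
    - apply/measurable_EFinP; apply: measurableT_comp => //; apply: measurable_funM => //.
      by apply: measurable_funS mpJ => // x [].
    - move=> x [_ /= le_s]; rewrite lee_fin ler_expR !mulNr lerN2 ler_wpM2l//.
      exact: ltW.
  apply: ge0_subset_integral => //.
  - apply/measurable_EFinP; apply: measurableT_comp => //; exact: measurable_funM.
  - by move=> x [].
Qed.

End ScaleFacts.

(** * Passage to the limit in the scale *)

Unset Implicit Arguments.

Theorem theorem4p30 (R : realType) (X : tvsType R)
  (X_hausdorff : hausdorff_space X) (X_quasicomplete : quasicomplete X)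
  (w : X) (mu : probability (borel X) R) (mu_radon : radon mu)
  (mu_exp : forall phi : dual X, mu.-integrable setT (fun x => (expR (phi x))%:E))
  (mu_disks : exists D : nat -> set X,
     (forall n, [/\ hereditarily_separable (D n), compact (D n) & disk (D n)]) /\
     mu (\bigcup_n D n) = 1%E)
  (nu2 : {measure set (borel (X * X)%type) -> \bar R})
  (nu2_radon_square : radon_square (translate mu w) nu2)
  (I : R -> X * X -> \bar R)
  (I_mem : forall k : R, 0 <= k -> calI (translate mu w) nu2 (I k))
  (I_incr : forall k l : R, 0 <= k -> k <= l ->
     calI_le (translate mu w) nu2 (I k) (I l))
  (Y : R -> set X) (B : R -> X -> X -> R)
  (I_rep : forall k : R, 0 <= k ->
     standard_rep (translate mu w) nu2 (I k) (Y k) (B k))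
  (d : R -> measure_display) (A : forall k : R, measurableType (d k))
  (kappa : forall k : R, {sigma_finite_measure set (A k) -> \bar R})
  (omega : forall k : R, A k -> cdual X)
  (A1_measurable : forall k : R, 0 <= k ->
     forall E : set (cdual X), @Xi R X E -> measurable (omega k @^-1` E))
  (A1_L2 : forall (k : R) (y : X), 0 <= k -> calH (translate mu w) y ->
     L2C (kappa k) (fun a => ceval (omega k a) y))
  (A1_dini : forall (k : R) (y : X), 0 <= k -> calH (translate mu w) y ->
     dini_upper_right (fun l => B l y y) k =
     (\int[kappa k]_a (csqnorm (ceval (omega k a) y))%:E)%E)
  (A2_measurable : forall l : R, 0 <= l ->
     completion_measurable mu (Qf' w (kappa l) (omega l) : borel X -> \bar R))
  (A2_lim : forall l : R, 0 <= l -> forall kn : nat -> R,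
     (forall n, 0 <= kn n /\ kn n != l) -> kn n @[n --> \oo] --> l ->
     exists rn : nat -> R,
       [/\ forall n, 0 < rn n, rn n @[n --> \oo] --> +oo &
           (\int[mu]_x expeR
              (`| (rn n * (Qf w (B l) x - Qf w (B (kn n)) x)
                     / (2 * (l - kn n)))%:E
                  - (rn n / 2)%:E * Qf' w (kappa l) (omega l) x |
               - (Qf w (B l) x / 2)%:E))%E
             @[n --> \oo] --> (\int[mu]_x (expR (- Qf w (B l) x / 2))%:E)%E])
  (A3 : forall k : R, 0 <= k -> exists2 r : R, 0 < r &
     (\int[mu]_x expeR ((1 / (2 * r))%:E * Qf' w (kappa k) (omega k) x
                         - (Qf w (B k) x / 2)%:E) < +oo)%E)
  (A4 : {ae nu2, forall p : X * X, I 0 p = 0%E})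
  (r : R -> R) (r_gt0 : forall k : R, 0 <= k -> 0 < r k)
  (r_lim : r k @[k --> +oo] --> +oo)
  (A5 : forall k : R, 0 <= k -> exists2 K : R, 0 <= K &
     forall l : R, 0 <= l -> K <= l ->
       calI_le (translate mu w) nu2 (Jf (r k) (I k)) (Jf (r l) (I l)))
  (YJ : R -> set X) (BJ : R -> X -> X -> R)
  (J_rep : forall k : R, 0 <= k ->
     standard_rep (translate mu w) nu2 (Jf (r k) (I k)) (YJ k) (BJ k))
  (A6 : forall kn : nat -> R, (forall n, 0 <= kn n) -> nondecreasing_seq kn ->
     kn n @[n --> \oo] --> +oo ->
     {ae (translate mu w), forall x : X,
        (ereal_sup (range (fun n => (BJ (kn n) x x)%:E)) < +oo)%E})
  (A7 : forall e : R, 0 < e ->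
     (0 < ereal_inf [set translate mu w [set x : X | YJ k x /\ BJ k x x <= e ^+ 2]%R
                    | k in [set k : R | 0 <= k]%R])%E)
  (y : X) (y_mem : calA mu y) (y_admissible : admissible mu B y)
  (F : \bar R) (F_exists : onsager_machlup mu w YJ BJ w y F) :
  average_action mu w (B k) y @[k --> +oo] --> F.
Proof.
have facts (k : R) (k0 : 0 <= k) := scale_facts X_hausdorff mu_radon mu_exp nu2_radon_square
  (I_mem k k0) (I_rep k k0) (r_gt0 k k0) (J_rep k k0) y_mem.
pose m (k s : R) : \bar R := ball_measure mu w (YJ k) (BJ k) w s.
pose m' (k s : R) : \bar R := ball_measure mu w (YJ k) (BJ k) y s.
have m_fin (k s : R) (k0 : 0 <= k) := ball_measure_fin X_hausdorff (J_rep k k0) y_mem s (or_introl erefl).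
have m'_fin (k s : R) (k0 : 0 <= k) := ball_measure_fin X_hausdorff (J_rep k k0) y_mem s (or_intror erefl).
have k_ge0 : \forall k \near +oo, 0 <= k :> R by exact: nbhs_pinfty_ge.
(* By [A7] the balls of radius [del / 2] at [w] have measure at least some [c1 > 0] at every scale.
   The lower bound this gives for [N] decays like [expR (- r k ^+ 2 * del ^+ 2 / 8)], more slowly
   than the tail [expR (- r k ^+ 2 * del ^+ 2 / 2)]. *)
have tail (del c : R) : 0 < del -> 0 < c ->
    \forall k \near +oo, forall N : R,
      (forall c0 s : R, 0 < c0 -> 0 < s -> (c0%:E <= m k s)%E ->
         c0 * expR (- (r k ^+ 2 / 2) * s ^+ 2) <= N) ->
      expR (- (r k ^+ 2 / 2) * del ^+ 2) <= c * N.
  move=> del0 c0.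
  have del20 : 0 < del / 2 by rewrite divr_gt0.
  have := A7 _ del20; set infm := ereal_inf _ => infm0.
  have [c1 c10 c1inf] : exists2 c1 : R, 0 < c1 & (c1%:E <= infm)%E.
    move: infm0; case: infm => [b||//]; last by exists 1; rewrite ?leey.
    by rewrite lte_fin => b0; exists b.
  have cc0 : 0 < c * c1 by rewrite mulr_gt0.
  have d0 : 0 < 3 * del ^+ 2 / 8 by rewrite divr_gt0// mulr_gt0// exprn_gt0.
  (* [3 * del ^+ 2 / 8] is the gap between the two exponents per unit of [r k ^+ 2]; the 1 ensures
     [r k <= r k ^+ 2]. *)
  pose M := 1 + `|ln (c * c1)| / (3 * del ^+ 2 / 8).
  have rM : \forall k \near +oo, M <= r k by move/cvgryPge : r_lim; exact.
  near=> k => N low.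
  have k0 : 0 <= k by near: k.
  have Mr : M <= r k by near: k.
  have M1 : 1 <= M by rewrite lerDl divr_ge0// ltW.
  have lowN : c1 * expR (- (r k ^+ 2 / 2) * (del / 2) ^+ 2) <= N.
    apply: low => //; apply: le_trans c1inf _; apply: ereal_inf_lbound.
    by exists k.
  rewrite -(ler_pM2l c0) mulrA in lowN; apply: le_trans lowN.
  rewrite -ler_ln ?posrE ?mulr_gt0 ?expR_gt0// lnM ?posrE ?expR_gt0// !expRK.
  have r1 : 1 <= r k by exact: le_trans Mr.
  have rr : M <= r k ^+ 2 by rewrite (le_trans Mr)// expr2 ler_peMr// (le_trans _ r1).
  have := ler_wpM2r (ltW d0) rr; rewrite /M mulrDl mul1r divfK ?gt_eqF//.
  have := ler_norm (- ln (c * c1)); rewrite normrN.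
  have := d0; nra.
(* The joint limit yields one radius [del] valid at all large scales. *)
have ratio_near (S : set (\bar R)) : nbhs F S -> exists2 del : R, 0 < del &
    \forall k \near +oo, forall s, 0 < s < del ->
      S (lne (m k s / m' k s)%E) /\ ~ (m k s = 0%E /\ m' k s = 0%E).
  move=> nS; have [nz lim] := F_exists.
  have := filterI nz (lim S nS) => -[[P1 P2] /= [nP1 [del /= del0 P2del]] P12].
  exists del => //; apply: filterS nP1 => k P1k s /andP[s0 sdel].
  have P2s : P2 s by apply: P2del => //=; rewrite sub0r normrN gtr0_norm.
  by have [] := P12 (k, s) (conj P1k P2s).
have adm eta : eta < 1 -> \forall k \near +oo,
    (eta%:E <= ereal_inf (range (fun phi : dual X =>
      (\int[translate mu y]_x (expR (phi x - B k x x / 2))%:E /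
       \int[translate mu y]_x (expR (- B k x x / 2))%:E)%E)))%E.
  move=> eta1.
  have lt1 : (eta%:E < 1)%E by rewrite lte_fin.
  have adm_nbhs := y_admissible _ (open_nbhs_nbhs (conj (@open_ereal_gt_ereal R _) lt1)).
  by near=> k; apply: ltW; near: k; exact: adm_nbhs.
apply: cvg_ereal_pinfty => t Ft.
- have [t0 Ft0 t0t] := ereal_lt_dense_r Ft.
  have [|del del0 near_ratio] := ratio_near [set v | (v < t0%:E)%E].
    by apply: open_nbhs_nbhs; split=> //; exact: open_ereal_lt_ereal.
  (* [eta] is lost twice, once to the tail and once to admissibility, and [t0 - 2 * ln eta = t]. *)
  pose eta := expR ((t0 - t) / 2).
  have eta0 : 0 < eta by exact: expR_gt0.
  have eta1 : eta < 1 by rewrite expR_lt1; lra.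
  have eta1' : 0 < 1 - eta by rewrite subr_gt0.
  have adm_eta := adm _ eta1; have tail_eta := tail _ _ del0 eta1'.
  near=> k.
  have k0 : 0 <= k by near: k.
  have [N [D0 [[N0 D00] act layer _ low]]] := facts k k0.
  have NP : N <= expR t0 * D0 + expR (- (r k ^+ 2 / 2) * del ^+ 2).
    apply: layer => // s s_itv.
    have near_k : forall s, 0 < s < del ->
      (lne (m k s / m' k s) < t0%:E)%E /\ ~ (m k s = 0%E /\ m' k s = 0%E) by near: k.
    have [lt_t0 nz] := near_k s s_itv.
    have [b b0 bE] := m_fin k s k0; have [b' b'0 b'E] := m'_fin k s k0.
    rewrite bE b'E -EFinM lee_fin; apply: lne_ratio_lt => //.
    + by rewrite -bE -b'E.
    + by rewrite -bE -b'E.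
  have tailN : expR (- (r k ^+ 2 / 2) * del ^+ 2) <= (1 - eta) * N.
    have tail_k : forall N : R,
      (forall c0 s : R, 0 < c0 -> 0 < s -> (c0%:E <= m k s)%E ->
         c0 * expR (- (r k ^+ 2 / 2) * s ^+ 2) <= N) ->
      expR (- (r k ^+ 2 / 2) * del ^+ 2) <= (1 - eta) * N by near: k.
    exact: tail_k.
  have adm_k : (eta%:E <= ereal_inf (range (fun phi : dual X =>
      (\int[translate mu y]_x (expR (phi x - B k x x / 2))%:E /
       \int[translate mu y]_x (expR (- B k x x / 2))%:E)%E)))%E by near: k.
  have /andP[_ act_le] := act _ eta0 adm_k.
  apply: le_trans act_le _; rewrite lee_fin.
  have : eta * N <= expR t0 * D0 by lra.
  have et0 := @expR_gt0 R t0.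
  rewrite -ler_ln ?posrE ?mulr_gt0// ln_div ?posrE// !lnM ?posrE//.
  by rewrite /eta !expRK; lra.
- have [t0 t0F tt0] := ereal_lt_dense_l Ft.
  have [|del del0 near_ratio] := ratio_near [set v | (t0%:E < v)%E].
    by apply: open_nbhs_nbhs; split=> //; exact: open_ereal_gt_ereal.
  (* With the tail at most [c * N], the comparison becomes [D0 <= expR (- t) * N]. *)
  pose c := expR (- t) - expR (- t0).
  have c0 : 0 < c by rewrite subr_gt0 ltr_expR ltrN2.
  (* The lower bound on the action does not involve [eta], so a fixed value is chosen. *)
  have half1 : 2^-1 < 1 :> R by rewrite invf_lt1// ltr1n.
  have half0 : 0 < 2^-1 :> R by rewrite invr_gt0.
  have adm_eta := adm _ half1; have tail_c := tail _ _ del0 c0.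
  near=> k.
  have k0 : 0 <= k by near: k.
  have [N [D0 [[N0 D00] act _ layer low]]] := facts k k0.
  have D0P : D0 <= expR (- t0) * N + expR (- (r k ^+ 2 / 2) * del ^+ 2).
    apply: layer => // s s_itv.
    have near_k : forall s, 0 < s < del ->
      (t0%:E < lne (m k s / m' k s))%E /\ ~ (m k s = 0%E /\ m' k s = 0%E) by near: k.
    have [lt_t0 _] := near_k s s_itv.
    have [b b0 bE] := m_fin k s k0; have [b' b'0 b'E] := m'_fin k s k0.
    rewrite bE b'E -EFinM lee_fin; apply: lne_ratio_gt => //.
    by rewrite -bE -b'E.
  have tailN : expR (- (r k ^+ 2 / 2) * del ^+ 2) <= c * N.
    have tail_k : forall N : R,
      (forall c0 s : R, 0 < c0 -> 0 < s -> (c0%:E <= m k s)%E ->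
         c0 * expR (- (r k ^+ 2 / 2) * s ^+ 2) <= N) ->
      expR (- (r k ^+ 2 / 2) * del ^+ 2) <= c * N by near: k.
    exact: tail_k.
  have adm_k : ((2^-1)%:E <= ereal_inf (range (fun phi : dual X =>
      (\int[translate mu y]_x (expR (phi x - B k x x / 2))%:E /
       \int[translate mu y]_x (expR (- B k x x / 2))%:E)%E)))%E by near: k.
  have /andP[act_ge _] := act _ half0 adm_k.
  apply: le_trans act_ge; rewrite lee_fin.
  have : D0 <= expR (- t) * N by rewrite /c in tailN; lra.
  have et := @expR_gt0 R (- t).
  rewrite -ler_ln ?posrE ?mulr_gt0// ln_div ?posrE// lnM ?posrE//.
  by rewrite expRK; lra.
Unshelve. all: by end_near. Qed.
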